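(* Let $p$ be a prime. If $\Gamma$ is a finite non-abelian group which has exactly $p$ one-dimensional representations, and $\widehat\Gamma$ is total, then $\widehat\Gamma$ does not have the Frucht property.
   Context: One-dimensional representations of $\Gamma$ are homomorphisms $\Gamma\to\mathbb C^\times$. The dual $\widehat\Gamma$ of a finite group is the finite quantum group with $C(\widehat\Gamma)=\mathrm{C}^*(\Gamma)=\mathbb C\Gamma$ and $\Delta(g)=g\otimes g$. For $g\in\Gamma$ of order $n$ and $w=e^{2\pi i/n}$, the Fourier-type transitive magic representation $u^g\in M_n(C(\widehat\Gamma))$ is $u^g_{kl}=\frac1n\sum_{m=1}^n w^{(k-l)m}g^m$. $u^g$ and $u^h$ are equivalent if $u^h=Pu^gP^{-1}$ for a permutation matrix $P$. The dual $\widehat\Gamma$ is total if for all $g_p,g_q\in\Gamma$ (of orders $N_p,N_q$), $1\le i,j\le N_p$, $1\le k,l\le N_q$: $u^{g_p}_{ij}u^{g_q}_{kl}=0$ implies that $u^{g_p},u^{g_q}$ are equivalent. A matrix over a $\mathrm{C}^*$-algebra is magic if its entries are projections summing to $1$ on each row and each column. $C(S_N^+)$ is the universal $\mathrm{C}^*$-algebra generated by the entries of an $N\times N$ magic matrix $u$, with $\Delta(u_{ij})=\sum_k u_{ik}\otimes u_{kj}$. A finite graph $X=(V,E)$, $|V|=N$, has $E\subset V\times V$ symmetric and irreflexive, with adjacency matrix $d\in M_N(0,1)$; its quantum automorphism group $G^+(X)$ has $C(G^+(X))=C(S_N^+)/\langle du=ud\rangle$ with induced comultiplication. A compact quantum group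 $G$ has the Frucht property if there exists a finite graph $X$ with $G=G^+(X)$ as abstract compact quantum groups (isomorphic via an isomorphism intertwining the comultiplications). *)

(* Defs.v *)
From HB Require Import structures.
From mathcomp Require Import all_boot all_order all_algebra all_fingroup.
From mathcomp Require Import all_classical all_reals all_analysis.
From mathcomp Require Import complex.

Set Implicit Arguments.
Unset Strict Implicit.
Unset Printing Implicit Defensive.

Import Order.TTheory GRing.Theory Num.Theory.
Import numFieldNormedType.Exports.

Local Open Scope classical_set_scope.
Local Open Scope ring_scope.

HB.mixin Record Algebra_isStar (K : numClosedFieldType) A
    of GRing.Algebra K A := {
  star : A -> A;
  starK : involutive star;
  starD : {morph star : x y / x + y};
  starM : forall x y, star (x * y) = star y * star x;
  starZ : forall (a : K) x, star (a *: x) = a^* *: star x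
}.

#[short(type="starAlgType")]
HB.structure Definition StarAlgebra (K : numClosedFieldType) :=
  {A of GRing.Algebra K A & Algebra_isStar K A}.

(* Joining [normedModType] with a ring structure is rejected by
   Hierarchy-Builder ([numDomainType] already joins norms and rings), so the
   norm is given here.  As in [normedModType K], it takes its values in [K], and
   [0 < e] forces [e] to be real. *)
HB.mixin Record StarAlgebra_isCStar (K : numClosedFieldType) A
    of StarAlgebra K A := {
  cnorm : A -> K;
  cnormD : forall x y, cnorm (x + y) <= cnorm x + cnorm y;
  cnormZ : forall (a : K) x, cnorm (a *: x) = `|a| * cnorm x;
  cnorm0_eq0 : forall x, cnorm x = 0 -> x = 0;
  cnormM : forall x y, cnorm (x * y) <= cnorm x * cnorm y;
  cnorm_star : forall x, cnorm (star x * x) = cnorm x ^+ 2;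
  cnorm_complete : forall s : nat -> A,
    (forall e : K, 0 < e -> exists N, forall m n, (N <= m)%N -> (N <= n)%N ->
       cnorm (s m - s n) < e) ->
    exists x, forall e : K, 0 < e -> exists N, forall n, (N <= n)%N ->
       cnorm (s n - x) < e
}.

#[short(type="cstarAlgType")]
HB.structure Definition CStarAlgebra (K : numClosedFieldType) :=
  {A of StarAlgebra K A & StarAlgebra_isCStar K A}.

Section StarNotions.
Variable K : numClosedFieldType.

Definition star_hom (A B : starAlgType K) (f : A -> B) : Prop :=
  [/\ linear f, GRing.monoid_morphism f & {morph f : x / star x}].

Definition projection (A : starAlgType K) (x : A) : Prop :=
  x * x = x /\ star x = x.

Definition magic (A : starAlgType K) (n : nat) (u : 'M[A]_n) : Prop :=
  [/\ forall i j, projection (u i j),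
      forall i, \sum_j u i j = 1
    & forall j, \sum_i u i j = 1].

Definition closed_ideal (A : cstarAlgType K) (I : set A) : Prop :=
  [/\ forall x, (forall e : K, 0 < e -> exists2 y, I y & cnorm (x - y) < e) ->
        I x,
      I 0,
      forall x y, I x -> I y -> I (x + y)
    & forall a x, I x -> I (a * x) /\ I (x * a)].

End StarNotions.

(* [A] together with the matrix [u] is [C(S_n^+)].  Uniqueness of the morphism
   says that [A] is generated by the entries of [u]. *)
Definition is_free_sym (K : numClosedFieldType) (n : nat)
    (A : cstarAlgType K) (u : 'M[A]_n) : Prop :=
  magic u /\
  forall (B : cstarAlgType K) (v : 'M[B]_n), magic v ->
    exists! f : A -> B, star_hom f /\ map_mx f u = v.

Record graph (n : nat) := Graph {
  edge :> rel 'I_n;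
  edge_sym : symmetric edge;
  edge_irr : irreflexive edge
}.

Definition adjmx (A : nzRingType) (n : nat) (X : graph n) : 'M[A]_n :=
  \matrix_(i, j) (X i j)%:R.

(* [B] together with the matrix [v] is the quotient [C(G^+(X))] of [C(S_n^+)]
   by the closed ideal of the relations [du = ud], [v] being the image of the
   fundamental matrix [u]. *)
Definition is_qaut (K : numClosedFieldType) (n : nat) (X : graph n)
    (B : cstarAlgType K) (v : 'M[B]_n) : Prop :=
  exists (A : cstarAlgType K) (u : 'M[A]_n) (pr : A -> B),
  let d := adjmx A X in
  let rels := [set (d *m u - u *m d) ij.1 ij.2 | ij in [set: 'I_n * 'I_n]] in
  [/\ is_free_sym u, star_hom pr, set_surj setT setT pr,
      (forall x, pr x = 0 <-> smallest (@closed_ideal K A) rels x)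
    & map_mx pr u = v].

Definition galg (K : numClosedFieldType) (gT : finGroupType) : Type :=
  {ffun gT -> K}.

Section GroupAlgebra.
Variables (K : numClosedFieldType) (gT : finGroupType).
Local Notation CG := (galg K gT).

HB.instance Definition _ := GRing.Lmodule.on CG.

Definition gelt (g : gT) : CG := [ffun x => (x == g)%:R].

Definition gmul (f h : CG) : CG := [ffun x => \sum_y f y * h (y^-1 * x)%g].

Definition gstar (f : CG) : CG := [ffun x => (f (x^-1)%g)^*].

Lemma gmulA : associative gmul.
Proof.
move=> f h k; apply/ffunP => x; rewrite !ffunE.
under eq_bigr => y _ do rewrite ffunE mulr_sumr.
under [RHS]eq_bigr => y _ do rewrite ffunE mulr_suml.
rewrite [RHS]exchange_big /=; apply: eq_bigr => y _.
rewrite (reindex_inj (mulgI y^-1%g)) /=; apply: eq_bigr => z _.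
by rewrite mulrA invMg invgK -!mulgA mulKVg.
Qed.

Lemma gmul1 : left_id (gelt 1%g) gmul.
Proof.
move=> f; apply/ffunP => x; rewrite ffunE (bigD1 1%g) //= ffunE eqxx mul1r.
by rewrite invg1 mul1g big1 ?addr0 // => y /negPf ny; rewrite ffunE ny mul0r.
Qed.

Lemma gmulr1 : right_id (gelt 1%g) gmul.
Proof.
move=> f; apply/ffunP => x; rewrite ffunE (bigD1 x) //= ffunE mulVg eqxx mulr1.
rewrite big1 ?addr0 // => y /negPf ny; rewrite ffunE.
by rewrite -(inj_eq (mulgI y)) mulKVg mulg1 eq_sym ny mulr0.
Qed.

Lemma gmulDl : left_distributive gmul +%R.
Proof.
move=> f h k; apply/ffunP => x; rewrite !ffunE -big_split /=.
by apply: eq_bigr => y _; rewrite ffunE mulrDl.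
Qed.

Lemma gmulDr : right_distributive gmul +%R.
Proof.
move=> f h k; apply/ffunP => x; rewrite !ffunE -big_split /=.
by apply: eq_bigr => y _; rewrite ffunE mulrDr.
Qed.

Lemma gelt1_neq0 : gelt 1%g != 0.
Proof.
by apply/eqP => /ffunP /(_ 1%g); rewrite !ffunE eqxx => /eqP; rewrite oner_eq0.
Qed.

HB.instance Definition _ := GRing.Zmodule_isNzRing.Build CG
  gmulA gmul1 gmulr1 gmulDl gmulDr gelt1_neq0.

Lemma gscaleAl (a : K) (f h : CG) : a *: (f * h) = (a *: f) * h.
Proof.
apply/ffunP => x; rewrite !ffunE scaler_sumr.
by apply: eq_bigr => y _; rewrite ffunE /GRing.scale /= mulrA.
Qed.

HB.instance Definition _ := GRing.Lmodule_isLalgebra.Build K CG gscaleAl.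

Lemma gscaleAr (a : K) (f h : CG) : a *: (f * h) = f * (a *: h).
Proof.
apply/ffunP => x; rewrite !ffunE scaler_sumr.
by apply: eq_bigr => y _; rewrite ffunE /GRing.scale /= mulrCA.
Qed.

HB.instance Definition _ := GRing.Lalgebra_isAlgebra.Build K CG gscaleAr.

Lemma gstarK : involutive gstar.
Proof. by move=> f; apply/ffunP => x; rewrite !ffunE invgK conjCK. Qed.

Lemma gstarD : {morph gstar : f h / f + h}.
Proof. by move=> f h; apply/ffunP => x; rewrite !ffunE rmorphD. Qed.

Lemma gstarM (f h : CG) : gstar (f * h) = gstar h * gstar f.
Proof.
apply/ffunP => x; rewrite !ffunE rmorph_sum /=.
rewrite (reindex_inj (mulgI x^-1%g)) /=; apply: eq_bigr => y _.
by rewrite !ffunE rmorphM /= mulrC !invMg !invgK mulgK.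
Qed.

Lemma gstarZ (a : K) (f : CG) : gstar (a *: f) = a^* *: gstar f.
Proof. by apply/ffunP => x; rewrite !ffunE rmorphM. Qed.

HB.instance Definition _ :=
  Algebra_isStar.Build K CG gstarK gstarD gstarM gstarZ.

(* [CG (x) CG] is identified with the group algebra of [gT * gT]. *)
Definition gtensor (f h : CG) : galg K (gT * gT)%type :=
  [ffun x => f x.1 * h x.2].

Definition gcomul (f : CG) : galg K (gT * gT)%type :=
  \sum_g f g *: gtensor (gelt g) (gelt g).

End GroupAlgebra.

Section Dual.
Variables (R : realType) (gT : finGroupType).

Definition unit_root (n : nat) : R[i] :=
  (cos (2 * pi / n%:R) +i* sin (2 * pi / n%:R))%C.

(* The indices are shifted by one, which leaves [k - l] unchanged. *)
Definition fourier_magic (g : gT) : 'M[galg R[i] gT]_#[g]%g :=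
  \matrix_(k, l) ((#[g]%g)%:R^-1 *:
    \sum_(1 <= m < (#[g]%g).+1)
      unit_root #[g]%g ^ ((k%:Z - l%:Z) * m%:Z) *: gelt R[i] g ^+ m).

Definition magic_equiv (A : nzRingType) (m n : nat)
    (u : 'M[A]_m) (v : 'M[A]_n) : Prop :=
  exists (e : m = n) (s : 'S_n),
    v = perm_mx s *m castmx (e, e) u *m perm_mx s^-1%g.

Definition total_dual : Prop :=
  forall (g h : gT) (i j : 'I_#[g]%g) (k l : 'I_#[h]%g),
    fourier_magic g i j * fourier_magic h k l = 0 ->
    magic_equiv (fourier_magic g) (fourier_magic h).

Definition one_dim_reps : set (gT -> R[i]) :=
  [set chi | (forall x, chi x != 0) /\
             (forall x y, chi (x * y)%g = chi x * chi y)].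

(* A bijective *-morphism of C*-algebras is isometric, so the norm of C*(gT)
   plays no role.  The comultiplication of [C(G^+(X))] is determined by
   [v i j |-> \sum_k v i k (x) v k j], and *-morphisms out of [C(G^+(X))] by
   their values on the [v i j], so [psi] intertwines the comultiplications as
   soon as it does on the [v i j]. *)
Definition frucht_dual : Prop :=
  exists (n : nat) (X : graph n) (B : cstarAlgType R[i]) (v : 'M[B]_n)
    (psi : B -> galg R[i] gT),
  [/\ is_qaut X v, star_hom psi, bijective psi
    & forall i j, gcomul (psi (v i j)) =
        \sum_k gtensor (psi (v i k)) (psi (v k j))].

End Dual.

Arguments one_dim_reps : clear implicits.

(* Main.v *)
Require Import Defs.
From HB Require Import structures.
From mathcomp Require Import all_boot all_order all_algebra all_fingroup.
From mathcomp Require Import all_solvable all_field all_character.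
From mathcomp Require Import all_classical all_reals all_analysis.
From mathcomp Require Import complex ring.
From mathcomp Require Import fintype finset.

(** Let [w] be the fundamental magic matrix of the quantum automorphism group of
a graph whose function algebra is the group algebra of [gT].  Read at [g], the
entries of [w] form a matrix [E_g] of scalars; the comultiplication says that
the [E_g] are orthogonal idempotents.  Attach to a vertex [i] the set [H_i]
([row_supp]) of the [g] for which the row [i] of [E_g] does not vanish.  Its
elements commute ([row_supp_comm]), the sets [H_i] generate [gT]
([row_supp_gen]), and [w i j] is supported in both [H_i] and [H_j].

The point is a gluing property ([glue_homs]).  Let [th_i] be morphisms from
[gT] to any finite group such that [th_i] and [th_j] agree on the intersection
of [H_i] and [H_j].  Apply [th_i] to the row [i] of [w].  The result is again
magic, and it commutes with the adjacency matrix [d]: the entry [(i, k)] of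
[d w = w d] is supported in [H_i] and in [H_k], where [th_i] and [th_k] agree.
The universal property then yields one morphism that restricts to [th_i] on
each [H_i].  To use it, a group algebra must be a C*-algebra, which the norm of
its left regular representation provides, and the kernel of a star morphism
into it must be closed ([star_hom_ker_closed]).

Totality makes every nontrivial element of [gT] of prime order
([total_prime_orders]): if [g] had order [n = d b] with [d, b > 1], some spectral
projections of [g] and [g ^+ d] would have product zero although their matrices
have different sizes.  The number of one-dimensional representations is the
index of the derived subgroup [N] ([card_one_dim_reps]), so this index is the
prime [p] and every element outside [N] has order [p].

These facts and the gluing property make [gT] abelian ([abelian_of_gluing]).
A local analysis shows that distinct Sylow [p]-subgroups meet inside [N]
([Sylow_inter_inside]).  Some [H_i] is not contained in [N], and it lies in a
Sylow subgroup [S].  Glue the quotient map modulo [N] on the [H_i] inside [S]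
with the trivial morphism on the others: the result coincides with the quotient
map, so each [H_i] lies in [S] or in [N].  Now take [c != 1] in the centre of
[S], a permutation action of [gT], and its conjugate by a permutation that
multiplies only part of the points by [c].  The action, used inside [S], and its
conjugate, used elsewhere, glue; the relation [(x t)^p = 1], for [x] in some
[H_i] inside [N] and [t] outside [N], survives the gluing only if [c] commutes
with [x].  So [c] is central in [gT], which is therefore a [p]-group with cyclic
abelianization, hence abelian. *)

Set Implicit Arguments.
Unset Strict Implicit.
Unset Printing Implicit Defensive.

Import Order.TTheory GRing.Theory Num.Theory.
Import numFieldNormedType.Exports.

(** * Groups whose nontrivial elements have prime order *)

Section GroupTheory.
Local Open Scope group_scope.

Section PrimeOrders.
Variable gT : finGroupType.
Implicit Types (x y t : gT) (D Q S : {group gT}).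
Hypothesis prime_orders : forall x, x != 1 -> prime #[x].
Local Notation G := [set: gT]%G.
Local Notation N := (G^`(1))%G.

(** Otherwise the orders are coprime, and [x * y] has order [#[x] * #[y]]. *)
Lemma commute_order_eq x y : x != 1 -> y != 1 -> commute x y -> #[x] = #[y].
Proof.
move=> x1 y1 cxy; have px := prime_orders x1; have py := prime_orders y1.
apply/eqP; apply: contraT => nxy.
have co : coprime #[x] #[y] by rewrite prime_coprime // dvdn_prime2.
have oxy := orderM cxy co.
have xy1 : x * y != 1.
  by rewrite -order_gt1 oxy (leq_trans (prime_gt1 px)) // leq_pmulr.
have := prime_orders xy1; rewrite oxy => /primeP[_ /(_ #[x])].
rewrite dvdn_mulr // => /(_ isT) /orP[/eqP e|].
  by move: (prime_gt1 px); rewrite e.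
by rewrite -{1}(muln1 #[x]) eqn_pmul2l // => /eqP e; move: (prime_gt1 py); rewrite -e.
Qed.

Lemma centralized_pgroup p (D : {group gT}) t :
  #[t] = p -> t != 1 -> t \in 'C(D) -> p.-group D.
Proof.
move=> ot t1 tC; apply/pgroupP => q q_pr /(Cauchy q_pr)[x Dx ox].
have x1 : x != 1 by rewrite -order_gt1 ox prime_gt1.
by rewrite inE -ox -ot (commute_order_eq x1 t1) //; exact/commute_sym/(centP tC).
Qed.

Variable p : nat.
Hypothesis p_pr : prime p.
Hypothesis indexN : #|G : N| = p.

(** The image of [t] in the quotient by [N] has order [p], which divides [#[t]]. *)
Lemma order_outside t : t \notin N -> #[t] = p.
Proof.
move=> Nt; have t1 : t != 1 by apply: contraNneq Nt => ->.
have nNt : t \in 'N(N) by rewrite (subsetP (der_norm 1 G)) ?inE.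
have : #[coset N t] %| #[t] by rewrite morph_order.
have : #[coset N t] %| p.
  by rewrite -indexN -card_quotient ?der_norm // order_dvdG // mem_quotient ?inE.
case/primeP: p_pr => _ pP /pP /orP[|/eqP->]; last first.
  by rewrite dvdn_prime2 ?prime_orders // => /eqP.
by rewrite order_eq1 => /eqP/coset_idr; rewrite (negPf Nt) => /(_ nNt).
Qed.

Lemma expg_outside t : t \notin N -> t ^+ p = 1.
Proof. by move/order_outside <-; rewrite expg_order. Qed.

Lemma mulg_outside x t : x \in N -> t \notin N -> x * t \notin N.
Proof. by move=> Nx Nt; rewrite groupMl. Qed.

Lemma conj_outside x t : t \notin N -> t ^ x \notin N.
Proof. by move=> Nt; rewrite memJ_norm // (subsetP (der_norm 1 G)) ?inE. Qed.


(** In multiplicative notation, [(v s^-1)^n s^n] is the product of the conjugates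
[v ^ (s^i)] for [i < n]. *)
Lemma expMg_conj_sum (V : {group gT}) (abV : abelian V) v s n :
    v \in V -> s \in 'N(V) ->
  FiniteModule.fmod abV ((v * s^-1) ^+ n * s ^+ n) =
    (\sum_(i < n) FiniteModule.actr (FiniteModule.fmod abV v) (s ^+ i))%R.
Proof.
move=> Vv Ns; have P k : (v * s^-1) ^+ k * s ^+ k \in V.
  elim: k => [|k IHk]; first by rewrite !expg0 mulg1 group1.
  rewrite expgSr -!mulgA (expgS s) mulKg.
  by rewrite (conjgC v (s ^+ k)) mulgA; apply: groupM => //; rewrite memJ_norm ?groupX.
elim: n => [|n IHn]; first by rewrite big_ord0 !expg0 mulg1 FiniteModule.fmod1.
rewrite big_ord_recr /= -IHn -FiniteModule.fmodJ ?groupX //.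
rewrite -FiniteModule.fmodM ?P //; last by rewrite memJ_norm ?groupX.
by rewrite expgSr -!mulgA (expgS s) mulKg -conjgC.
Qed.

(** Sum the conjugates of [v] in [V] under [(t ^ y) ^+ i], for [y] in [Q] and
[i < p], in two ways.  For fixed [y] the sum is the [p]-th power of an element
outside [N], hence trivial.  For fixed [i] other than 0, the map sending [y] to
[[~ t ^+ i, y]] permutes [Q], so the sum is a sum over [Q]; it is fixed by [Q],
hence trivial, as the orders in [V] and [Q] differ.  What remains is the term
[i = 0], which is [v ^+ #|Q|]. *)
Lemma frobenius_norm_trivial (V Q : {group gT}) t :
    abelian V -> p.-group V -> V \subset N -> t \in 'N(V) -> t \in 'N(Q) ->
    t \notin N -> Q \subset 'N(V) -> p^'.-group Q -> Q != 1%G -> V :=: 1.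
Proof.
move=> abV pV sVN tNV tNQ tN sQNV p'Q Q1.
pose act := @FiniteModule.actr _ V abV.
have p'o x : x \in Q -> x != 1 -> #[x] != p.
  move=> Qx x1; have := mem_p_elt p'Q Qx; rewrite /p_elt /order -/(order x).
  by rewrite p'natE //; apply: contraNneq => ->.
have pV1 u : u \in V -> u != 1 -> #[u] = p.
  move=> Vu u1; have := mem_p_elt pV Vu; have := prime_orders u1.
  by rewrite /p_elt => /pnatE -> ; rewrite inE => /eqP.
have sumQ u : (\sum_(y in Q) act u y = 0)%R.
  set w := (\sum_(y in Q) _)%R.
  have [x Qx x1] : exists2 x, x \in Q & x != 1.
    by apply/trivgPn; apply: contra Q1 => /eqP/val_inj ->.
  have fixw : act w x = w.
    rewrite /w /act (big_morph _ (FiniteModule.actAr x) (FiniteModule.act0r _ x)) /=.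
    rewrite [RHS](reindex_inj (mulIg x)) /=.
    apply: eq_big => [y|y Qy]; first by rewrite groupMr.
    by rewrite FiniteModule.actrM ?(subsetP sQNV).
  apply: FiniteModule.fmod_inj => /=; apply/eqP.
  apply: contraT => w1; have := congr1 val fixw.
  rewrite FiniteModule.fmvalJ ?(subsetP sQNV) // => /esym/eqP.
  move=> /eqP/esym/conjg_fixP/commgP cwx.
  have := commute_order_eq w1 x1 cwx.
  by rewrite pV1 ?FiniteModule.fmodP // => /esym/eqP; rewrite (negPf (p'o _ Qx x1)).
have sumt u y : y \in Q -> (\sum_(i < p) act u ((t ^ y) ^+ i)%g = 0)%R.
  move=> Qy; rewrite -(FiniteModule.fmvalK u).
  have tyN : t ^ y \in 'N(V) by apply: groupJ => //; exact: (subsetP sQNV).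
  rewrite -expMg_conj_sum ?FiniteModule.fmodP //.
  rewrite (expg_outside (conj_outside y tN)) mulg1 expg_outside ?FiniteModule.fmod1 //.
  apply: mulg_outside; first by rewrite (subsetP sVN) ?FiniteModule.fmodP.
  by rewrite groupV conj_outside.
have ot : #[t] = p by exact: order_outside.
have sumi u (i : 'I_p) : i != 0 :> nat -> (\sum_(y in Q) act u ((t ^ y) ^+ i)%g = 0)%R.
  move=> i0; have ti1 : t ^+ i != 1.
    by rewrite -order_dvdn ot gtnNdvd // lt0n.
  have oti : #[t ^+ i] = p.
    rewrite orderXgcd ot (eqP (_ : coprime p i)) ?divn1 //.
    by rewrite prime_coprime // gtnNdvd // lt0n.
  rewrite -[RHS](sumQ (act u (t ^+ i))).
  have injf : {in Q &, injective (fun y => [~ t ^+ i, y])}.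
    move=> y z Qy Qz /mulgI /(congr1 (conjg^~ y^-1)).
    rewrite conjgK -conjgM => /esym/conjg_fixP/commgP c.
    apply/esym/eqP; rewrite eq_mulgV1; apply: contraT => yz1.
    have := commute_order_eq ti1 yz1 c; rewrite oti => /esym/eqP.
    by rewrite (negPf (p'o _ _ yz1)) // groupM ?groupV.
  have imf : [set [~ t ^+ i, y] | y in Q] = Q :> {set gT}.
    apply/eqP; rewrite eqEcard card_in_imset // leqnn andbT.
    apply/subsetP => _ /imsetP[y Qy ->].
    by rewrite commgEr groupMl // memJ_norm ?groupV // groupX.
  rewrite -[in RHS]imf big_imset //=; apply: eq_bigr => y Qy.
  rewrite /act -FiniteModule.actrM ?groupX //; first by rewrite -conjXg mulKVg.
  by rewrite commgEl groupM ?groupV ?groupJ ?groupX // (subsetP sQNV).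
apply/trivgP/subsetP => v Vv; rewrite inE.
pose u := FiniteModule.fmod abV v.
have : (\sum_(y in Q) \sum_(i < p) act u ((t ^ y) ^+ i)%g = 0)%R.
  by rewrite big1 // => y Qy; exact: sumt.
rewrite exchange_big /= (bigD1 (Ordinal (prime_gt0 p_pr))) //=.
rewrite [X in (_ + X)%R]big1 => [|i i0]; last first.
  by apply: sumi; apply: contra i0 => /eqP e; apply/eqP/val_inj.
under eq_bigr do rewrite expg0 /act FiniteModule.actr1.
rewrite addr0 sumr_const -FiniteModule.fmodX // -FiniteModule.fmod1 => /(congr1 val).
rewrite !FiniteModule.fmodK ?groupX // => /eqP; rewrite -order_dvdn.
apply: contraLR => v1; rewrite pV1 //.
by move: p'Q; rewrite /pgroup p'natE.
Qed.


(** Assume that another prime [q] divides the order of ['N(D)].  The Frattini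
argument yields a [q]-subgroup [Q] of [N] and some [t] outside [N], both
normalizing [D], such that [t] normalizes [Q].  By [frobenius_norm_trivial] on the
centre of [D :&: N], this intersection is trivial.  It contains the commutators
of [Q] and [D], so [Q] commutes with elements of order [p]. *)
Lemma norm_pgroup D : p.-group D -> ~~ (D \subset N) -> p.-group 'N(D).
Proof.
move=> pD /subsetPn[d Dd dN].
pose U := ('N(D))%G; pose U0 := (U :&: N)%G.
have nNU : U \subset 'N(N) by rewrite (subset_trans (subsetT _)) ?der_norm.
have nsU0 : normal U0 U by rewrite /normal subsetIl normsI ?normG.
apply/pgroupP => q q_pr /(Cauchy q_pr)[x Ux ox]; rewrite inE /=.
apply: contraT => qp.
have x1 : x != 1 by rewrite -order_gt1 ox prime_gt1.
have Nx : x \in N by apply: contraNT qp => /order_outside; rewrite ox => ->.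
have [Q sylQ] := Sylow_exists q U0.
have qQ := pHall_pgroup sylQ; have sQU0 := pHall_sub sylQ.
have p'Q : p^'.-group Q.
  by apply: sub_in_pnat qQ => r _; rewrite !inE => /eqP->.
have Q1 : Q != 1%G.
  apply/eqP => Q1; have := card_Hall sylQ; rewrite Q1 cards1 => /esym/eqP.
  rewrite partn_eq1 // p'natE // => /negP; apply.
  by rewrite -ox order_dvdG // inE Ux.
have [t tNQ tN] : exists2 t, t \in U :&: 'N(Q) & t \notin N.
  have : d \in U0 * (U :&: 'N(Q)) by rewrite (Frattini_arg nsU0 sylQ) (subsetP (normG D)).
  case/mulsgP=> u t Uu Ut e; exists t => //.
  by apply: contra dN => Nt; rewrite e groupM //; case/setIP: Uu.
have /setIP[Ut tQ] := tNQ.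
pose D0 := (D :&: N)%G.
have nD0U : U \subset 'N(D0) by rewrite normsI ?normG ?subxx.
have nZU : U \subset 'N('Z(D0)) by rewrite gFnorm_trans.
have pD0 : p.-group D0 by rewrite (pgroupS (subsetIl _ _)).
have sQU : Q \subset U by rewrite (subset_trans sQU0) ?subsetIl.
have Z1 : 'Z(D0) = 1.
  apply: (@frobenius_norm_trivial 'Z(D0)%G Q t) => //.
  - exact: center_abelian.
  - by rewrite (pgroupS (center_sub _)).
  - by rewrite (subset_trans (center_sub _)) ?subsetIr.
  - by rewrite (subsetP nZU).
  - exact: subset_trans nZU.
have D01 : D0 :=: 1 := trivg_center_pgroup pD0 Z1.
have [y Qy y1] : exists2 y, y \in Q & y != 1.
  by apply/trivgPn; apply: contra Q1 => /eqP/val_inj ->.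
have d1 : d != 1 by apply: contraNneq dN => ->.
have cyd : commute y d.
  apply/commgP; rewrite -in_set1 -[[set 1]]/(1%g : {set gT}) -D01 inE; apply/andP; split.
    by rewrite commgEr groupM // memJ_norm ?groupV // (subsetP sQU).
  by rewrite mem_commg ?inE.
have := commute_order_eq y1 d1 cyd; rewrite (order_outside dN) => oy.
by have := mem_p_elt p'Q Qy; rewrite /p_elt oy p'natE // dvdnn.
Qed.

(** Take a largest intersection [D] of two distinct Sylow subgroups that is not
contained in [N].  Its normalizer is a [p]-group, hence lies in a Sylow subgroup
[S3], which meets both [S1] and [S2] in more than [D]; so [S3] equals both. *)
Lemma Sylow_inter_inside (S1 S2 : {group gT}) x :
  p.-Sylow(G) S1 -> p.-Sylow(G) S2 -> x \in S1 -> x \in S2 -> x \notin N -> S1 :=: S2.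
Proof.
have [n] := ubnP (#|G| - #|S1 :&: S2|); elim: n S1 S2 => // n IHn S1 S2.
move=> len syl1 syl2 S1x S2x xN.
pose D := (S1 :&: S2)%G.
have pD : p.-group D by rewrite (pgroupS (subsetIl _ _)) ?(pHall_pgroup syl1).
have DN : ~~ (D \subset N) by apply/subsetPn; exists x => //; rewrite inE S1x.
have [S3 syl3 sNS3] := Sylow_superset (subsetT _) (norm_pgroup pD DN).
have key (S : {group gT}) : p.-Sylow(G) S -> x \in S -> S1 :&: S2 \proper S -> S :=: S3.
  move=> sylS Sx prDS.
  have pr := nilpotent_proper_norm (pgroup_nil (pHall_pgroup sylS)) prDS.
  have S3x : x \in S3 by rewrite (subsetP sNS3) // (subsetP (normG D)) // inE S1x.
  apply: IHn => //; rewrite -ltnS; apply: leq_trans len; rewrite ltnS ltn_sub2l //.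
    apply: leq_trans (subset_leq_card (subsetT S)); exact: proper_card.
  apply: leq_trans (proper_card pr) (subset_leq_card _).
  by apply: setIS.
have eqS (S T : {group gT}) : p.-Sylow(G) S -> p.-Sylow(G) T -> S \subset T -> S :=: T.
  move=> sylS sylT sST; apply/eqP; rewrite eqEcard sST.
  by rewrite (card_Hall sylS) (card_Hall sylT) leqnn.
have [s12|n12] := boolP (S1 \subset S2); first exact: eqS.
have n21 : ~~ (S2 \subset S1).
  by apply: contra n12 => s21; rewrite (eqS _ _ syl2 syl1 s21).
have e1 : S1 :=: S3.
  apply: key => //; rewrite properEneq subsetIl andbT.
  by apply: contra n12 => /eqP <-; exact: subsetIr.
have e2 : S2 :=: S3.
  apply: key => //; rewrite properEneq subsetIr andbT.
  by apply: contra n21 => /eqP <-; exact: subsetIl.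
by rewrite e1 e2.
Qed.


Lemma der1_maximal (D : {group gT}) t : N \subset D -> t \in D -> t \notin N -> D :=: G.
Proof.
move=> sND Dt tN; have := Lagrange_index (subsetT D) sND; rewrite indexN => e.
have : #|D : N| %| p by rewrite -e dvdn_mull.
case/primeP: p_pr => _ pP /pP /orP[/eqP i1|/eqP ip].
  by case/negP: tN; rewrite (subsetP (_ : D \subset N)) // -indexg_eq1 i1.
apply/eqP; rewrite eqEsubset subsetT -indexg_eq1 /=; move/eqP: e.
by rewrite ip -{2}(mul1n p) eqn_pmul2r ?prime_gt0.
Qed.

Lemma expg_outside_notin y k : y \notin N -> 0 < k < p -> y ^+ k \notin N.
Proof.
move=> yN /andP[k0 kp]; apply: contra (yN) => ykN.
have /eqP g : generator <[y]> (y ^+ k).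
  by rewrite generator_coprime (order_outside yN) prime_coprime // gtnNdvd.
have sN : <[y ^+ k]> \subset N by rewrite cycle_subG.
by rewrite (subsetP sN) // -g cycle_id.
Qed.

Lemma coset_der1_commute (a b : coset_of N) : commute a b.
Proof.
have [x _ ->] := cosetP a; have [y _ ->] := cosetP b.
have ab : abelian (G / N) by exact: der_abelian 0 G.
by apply: (centsP ab); rewrite mem_quotient ?inE.
Qed.

Lemma der1_sub_ker (rT : finGroupType) (f : gT -> rT) :
  {morph f : x y / x * y} -> (forall a b : rT, commute a b) ->
  forall x, x \in N -> f x = 1.
Proof.
move=> fM cT.
have f1 : f 1 = 1 by apply: (mulgI (f 1)); rewrite -fM !mulg1.
have fV x : f x^-1 = (f x)^-1 by apply: (mulgI (f x)); rewrite -fM !mulgV.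
have gK : group_set [set x | f x == 1].
  apply/group_setP; split; first by rewrite inE f1.
  by move=> x y; rewrite !inE fM => /eqP-> /eqP->; rewrite mulg1.
suff /subsetP sNK : N \subset Group gK by move=> x /sNK; rewrite inE => /eqP.
rewrite gen_subG; apply/subsetP => _ /imset2P[x y _ _ ->].
by rewrite inE !fM !fV -/([~ f x, f y]); apply/commgP.
Qed.
End PrimeOrders.

Section Diag.
Variables (gT : finGroupType) (M : {group gT}) (c : gT).

Definition diag_fun x (u : gT * gT) := (u.1 * x, u.2 * x).
Lemma diag_inj x : injective (diag_fun x).
Proof. by move=> [a b] [a' b'] [/mulIg-> /mulIg->]. Qed.
(** The second coordinate keeps track of the coset of [M] that a point lies in,
and [twist] below alters the first coordinate over [M] only. *)
Definition diag x : {perm gT * gT} := perm (@diag_inj x).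

Lemma diagE x u : diag x u = (u.1 * x, u.2 * x).
Proof. exact: permE. Qed.

Lemma diagM : {morph diag : x y / x * y}.
Proof. by move=> x y; apply/permP => u; rewrite permM !diagE /= !mulgA. Qed.

Definition twist_fun (u : gT * gT) := if u.2 \in M then (u.1 * c, u.2) else u.
Lemma twist_inj : injective twist_fun.
Proof.
move=> [a b] [a' b']; rewrite /twist_fun /=.
case: ifP => Mb; case: ifP => Mb' e //; first by case: e => /mulIg-> ->.
  by case: e => _ eb; rewrite -eb Mb in Mb'.
by case: e => _ eb; rewrite eb Mb' in Mb.
Qed.
Definition twist : {perm gT * gT} := perm twist_inj.

Lemma twistE u : twist u = if u.2 \in M then (u.1 * c, u.2) else u.
Proof. exact: permE. Qed.
Lemma twistVE u : twist^-1 u = if u.2 \in M then (u.1 * c^-1, u.2) else u.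
Proof.
apply: (canLR (permK twist)); case: ifP => Mu; rewrite twistE /= Mu //.
by rewrite mulgKV -surjective_pairing.
Qed.

Lemma diagJ x u : x \in M ->
  (diag x ^ twist) u = if u.2 \in M then (u.1 * x ^ c, u.2 * x) else diag x u.
Proof.
move=> Mx; rewrite conjgE !permM twistVE; case: ifP => Mu.
  by rewrite diagE /= twistE /= groupMr // Mu conjgE !mulgA.
by rewrite diagE /= twistE /= groupMr // Mu.
Qed.

Lemma diagJ_id x : x \in M -> commute c x -> diag x ^ twist = diag x.
Proof.
move=> Mx cx; apply/permP => u; rewrite diagJ //; case: ifP => // _.
by rewrite diagE /conjg -cx mulKg.
Qed.

(** Follow the point [(1, 1)] under the powers of the permutation: its second
coordinate [(x * t) ^+ k] is in [M] only at the start, so the first coordinate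
ends at [x ^ c * t * (x * t) ^+ p.-1] instead of [(x * t) ^+ p]. *)
Lemma diagJ_expg (p : nat) x t : x \in M -> (0 < p)%N -> 
    (forall k, 0 < k < p -> (x * t) ^+ k \notin M) ->
  (diag x ^ twist * diag t) ^+ p = 1 -> (x * t) ^+ p = 1 -> commute c x.
Proof.
move=> Mx; case: p => // p _ out e1 e2.
have P k : (k <= p)%N -> ((diag x ^ twist * diag t) ^+ k.+1) (1, 1) =
    (x ^ c * t * (x * t) ^+ k, (x * t) ^+ k.+1).
  elim: k => [_|k IHk lek].
    by rewrite expg1 expg0 permM diagJ //= group1 diagE /= !mul1g mulg1.
  rewrite expgSr permM IHk 1?ltnW // permM diagJ //= (negPf (out k.+1 _)) //.
  by rewrite !diagE /= (expgSr (x * t) k.+1) (expgSr (x * t) k) -!mulgA.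
have := P p (leqnn p); rewrite e1 perm1 => -[/esym e _].
have : x ^ c = x by apply: (mulIg (t * (x * t) ^+ p)); rewrite !mulgA e -e2 expgS.
by move=> /conjg_fixP/commgP/commute_sym.
Qed.
End Diag.

(** The gluing property is used twice, with values in the quotient by [N] to locate
the sets [H i], and with values in permutations to obtain a central element. *)
Lemma abelian_of_gluing (gT : finGroupType) (I : finType) (H : I -> {set gT}) (p : nat) :
    prime p -> (forall x : gT, x != 1 -> prime #[x]) ->
    #|[set: gT] : [set: gT]^`(1)| = p ->
    (forall i, {in H i &, forall x y, commute x y}) ->
    <<\bigcup_i H i>> = [set: gT] ->
    (forall (rT : finGroupType) (f : I -> gT -> rT),
      (forall i, {morph f i : x y / x * y}) ->
      (forall i j x, x \in H i -> x \in H j -> f i x = f j x) ->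
      exists2 F : gT -> rT, {morph F : x y / x * y} & forall i, {in H i, F =1 f i}) ->
  abelian [set: gT].
Proof.
move=> p_pr orders index_p Habel genH glue.
set G := [set: gT]%G; set N := (G^`(1))%G.
have [i0 Hi0] : exists i, ~~ (H i \subset N).
  apply/existsP; apply: contraT; rewrite negb_exists => /forallP sH.
  have : [set: gT] \subset N.
    by rewrite -genH gen_subG; apply/bigcupsP => i _; have := sH i; rewrite negbK.
  rewrite -indexg_eq1 index_p => /eqP p1; by move: p_pr; rewrite p1.
have Hp i : ~~ (H i \subset N) -> exists2 S : {group gT}, p.-Sylow(G) S & H i \subset S.
  case/subsetPn=> t Ht tN.
  have t1 : t != 1 by apply: contraNneq tN => ->.
  have pH : p.-group <<H i>>.
    apply: (centralized_pgroup orders (order_outside orders p_pr index_p tN)) t1 _.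
    rewrite cent_gen; apply/centP => x Hx; exact: (Habel i).
  have [S sylS sHS] := Sylow_superset (subsetT _) pH.
  by exists S => //; apply: subset_trans sHS; exact: subset_gen.
have [S sylS sH0S] := Hp _ Hi0.
have [t Ht tN] := subsetPn Hi0.
have in_S i x : x \in H i -> x \in S -> x \notin N -> H i \subset S.
  move=> Hx Sx xN.
  have [T sylT sHT] : exists2 T : {group gT}, p.-Sylow(G) T & H i \subset T.
    by apply: Hp; apply/subsetPn; exists x.
  rewrite (Sylow_inter_inside orders p_pr index_p sylS sylT Sx _ xN) //.
  exact: (subsetP sHT).
(* Gluing the quotient map inside S with the trivial morphism elsewhere. *)
have S_or_N i : (H i \subset S) || (H i \subset N).
  pose f i x : coset_of N := if H i \subset S then coset N x else 1.
  have fM j : {morph f j : x y / x * y}.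
    move=> x y; rewrite /f; case: ifP => _; last by rewrite mulg1.
    by rewrite morphM // (subsetP (der_norm 1 G)) ?inE.
  have fE j k x : x \in H j -> x \in H k -> f j x = f k x.
    move=> Hj Hk; rewrite /f.
    have [Nx|xN] := boolP (x \in N); first by rewrite coset_id ?if_same.
    case: ifP => sj; case: ifP => sk //.
      by case/negP: (negbT sk); apply: (in_S k x) => //; exact: (subsetP sj).
    by case/negP: (negbT sj); apply: (in_S j x) => //; exact: (subsetP sk).
  have [F FM FE] := glue _ f fM fE.
  have gD : group_set [set x | F x == coset N x].
    apply/group_setP; split.
      have F1 : F 1 = 1 by apply: (mulgI (F 1)); rewrite -FM !mulg1.
      by rewrite inE F1 morph1.
    move=> x y; rewrite !inE FM => /eqP-> /eqP->.
    by rewrite morphM // (subsetP (der_norm 1 G)) ?inE.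
  have DG : Group gD :=: G.
    apply: (der1_maximal p_pr index_p) (_ : t \in _) tN.
      apply/subsetP => x Nx; rewrite inE coset_id //.
      by apply/eqP; apply: der1_sub_ker Nx => //; exact: coset_der1_commute.
    by rewrite inE (FE _ _ Ht) /f sH0S.
  have [//|nsS] := boolP (H i \subset S); rewrite /=.
  apply/subsetP => x Hx.
  have : x \in Group gD by rewrite DG inE.
  rewrite inE (FE _ _ Hx) /f (negPf nsS) => /eqP/esym e; apply: coset_idr e.
  by rewrite (subsetP (der_norm 1 G)) ?inE.
have pS := pHall_pgroup sylS.
have S1 : S :!=: 1.
  apply/trivgPn; exists t; first exact: (subsetP sH0S).
  by apply: contraNneq tN => ->.
have [c Zc c1] : exists2 c, c \in 'Z(S) & c != 1.
  by apply/trivgPn; apply: contra S1 => /eqP /(trivg_center_pgroup pS)/eqP.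
have /centerP[Sc cS] := Zc.
(* Gluing a permutation action inside S with its conjugate elsewhere. *)
have cG : c \in 'C([set: gT]).
  pose b := twist N c.
  pose f i x := if H i \subset S then diag x else diag x ^ b.
  have fM i : {morph f i : x y / x * y}.
    by move=> x y; rewrite /f; case: ifP => _; rewrite diagM // conjMg.
  have fE j k x : x \in H j -> x \in H k -> f j x = f k x.
    move=> Hj Hk; rewrite /f.
    have sub l m : H l \subset S -> ~~ (H m \subset S) ->
        x \in H l -> x \in H m -> diag x ^ b = diag x.
      move=> sl sm Hl Hm; apply: diagJ_id; last by apply: cS; apply: (subsetP sl).
      by move: (S_or_N m); rewrite (negPf sm) => /subsetP; apply.
    case: ifP => sj; case: ifP => sk //.
      by rewrite (sub j k) ?sk.
    by rewrite (sub k j) ?sj.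
  have [F FM FE] := glue _ f fM fE.
  rewrite -genH cent_gen; apply/centP => x /bigcupP[i _ Hx].
  have [sHS|nHS] := boolP (H i \subset S); first by apply: cS; exact: (subsetP sHS).
  have Nx : x \in N by move: (S_or_N i); rewrite (negPf nHS) => /subsetP; apply.
  have xtN : x * t \notin N by rewrite groupMl.
  apply: (@diagJ_expg gT N c p x t) => //.
  - exact: prime_gt0.
  - by move=> k; exact: expg_outside_notin xtN.
  - have -> : diag x ^ twist N c * diag t = F (x * t).
      by rewrite FM (FE _ _ Hx) (FE _ _ Ht) /f (negPf nHS) sH0S.
    have FX n : F ((x * t) ^+ n) = F (x * t) ^+ n.
      elim: n => [|n IHn]; last by rewrite expgS [in RHS]expgS -IHn -FM.
      by rewrite !expg0; apply: (mulgI (F 1)); rewrite -FM !mulg1.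
    rewrite -FX (expg_outside orders p_pr index_p xtN).
    by apply: (mulgI (F 1)); rewrite -FM !mulg1.
  - exact: expg_outside xtN.
have pG : p.-group G.
  apply: (centralized_pgroup orders _ c1 cG).
  by have := mem_p_elt pS Sc; rewrite /p_elt (pnatE _ (orders c c1)) inE => /eqP.
have : cyclic G.
  apply: cyclic_nilpotent_quo_der1_cyclic (pgroup_nil pG) _.
  by apply: prime_cyclic; rewrite card_quotient ?der_norm // index_p.
exact: cyclic_abelian.
Qed.
End GroupTheory.

Local Open Scope ring_scope.

(** * The C*-norm of a group algebra *)

(** By the identity of Lagrange, twice the difference of the two sides is a sum
of squares. *)
Lemma sumr_CauchySchwarz (R : realDomainType) (I : finType) (a b : I -> R) :
  (\sum_i a i * b i) ^+ 2 <= (\sum_i a i ^+ 2) * (\sum_i b i ^+ 2).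
Proof.
have : 0 <= \sum_i \sum_j (a i * b j - a j * b i) ^+ 2.
  by do 2!apply: sumr_ge0 => ? _; exact: sqr_ge0.
have -> : \sum_i \sum_j (a i * b j - a j * b i) ^+ 2 =
    ((\sum_i a i ^+ 2) * (\sum_i b i ^+ 2) - (\sum_i a i * b i) ^+ 2) *+ 2.
  have E1 : (\sum_i a i ^+ 2) * (\sum_i b i ^+ 2) =
      \sum_i \sum_j a i ^+ 2 * b j ^+ 2 by rewrite big_distrlr.
  have E2 : (\sum_i a i * b i) ^+ 2 = \sum_i \sum_j a i * b i * (a j * b j).
    by rewrite expr2 big_distrlr.
  rewrite mulr2n {1}E1 [X in _ + (X - _)]mulrC big_distrlr E2 /=.
  rewrite -sumrB -sumrB -big_split; apply: eq_bigr => i _ /=.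
  rewrite -sumrB -sumrB -big_split; apply: eq_bigr => j _ /=.
  by ring.
by rewrite pmulrn_lge0 // subr_ge0.
Qed.


Section Modulus.
Variable R : realType.
Implicit Types z t : R[i].

Definition nrm z : R := complex.Re `|z|.

Lemma nrmE z : `|z| = (nrm z)%:C%C.
Proof. by rewrite RRe_real ?normr_real. Qed.

Lemma nrm_ge0 z : 0 <= nrm z.
Proof. by rewrite -ler0c -nrmE normr_ge0. Qed.

Lemma nrmM z t : nrm (z * t) = nrm z * nrm t.
Proof. by apply: complexI; rewrite rmorphM /= -!nrmE normrM. Qed.

Lemma nrmD z t : nrm (z + t) <= nrm z + nrm t.
Proof. by rewrite -lecR rmorphD /= -!nrmE ler_normD. Qed.

Lemma nrm0 : nrm 0 = 0.
Proof. by apply: complexI; rewrite -nrmE normr0. Qed.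

Lemma nrm1 : nrm 1 = 1.
Proof. by apply: complexI; rewrite -nrmE normr1. Qed.

Lemma nrm0_eq0 z : nrm z = 0 -> z = 0.
Proof. by move=> z0; apply/normr0_eq0; rewrite nrmE z0. Qed.

Lemma nrm_sum (I : finType) (F : I -> R[i]) : nrm (\sum_i F i) <= \sum_i nrm (F i).
Proof.
rewrite -lecR -nrmE rmorph_sum /=; apply: le_trans (ler_norm_sum _ _ _) _.
by apply: ler_sum => i _; rewrite nrmE.
Qed.

End Modulus.

Section Norm.
Variables (R : realType) (gT : finGroupType).
Local Notation K := R[i].
Local Notation CG := (galg K gT).
Implicit Types (x y f h : CG).

Definition sqnorm f : R := \sum_g nrm (f g) ^+ 2.
Definition l2norm f : R := Num.sqrt (sqnorm f).

Lemma sqnorm_ge0 f : 0 <= sqnorm f.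
Proof. by apply: sumr_ge0 => g _; exact: sqr_ge0. Qed.

Lemma l2norm_ge0 f : 0 <= l2norm f.
Proof. exact: sqrtr_ge0. Qed.

Lemma sqr_l2norm f : l2norm f ^+ 2 = sqnorm f.
Proof. by rewrite sqr_sqrtr ?sqnorm_ge0. Qed.

Lemma l2norm_eq0 f : l2norm f = 0 -> f = 0.
Proof.
move=> f0; have sq0 : sqnorm f = 0 by rewrite -sqr_l2norm f0 expr0n.
apply/ffunP => g; rewrite ffunE; apply: nrm0_eq0; apply/eqP; rewrite -sqrf_eq0.
have := sq0; rewrite /sqnorm => /psumr_eq0P => z0.
by rewrite z0 // => i _; exact: sqr_ge0.
Qed.

Lemma l2normZ a f : l2norm (a *: f) = nrm a * l2norm f.
Proof.
have -> : l2norm (a *: f) = Num.sqrt (nrm a ^+ 2 * sqnorm f).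
  congr Num.sqrt; rewrite /sqnorm mulr_sumr; apply: eq_bigr => g _.
  by rewrite !ffunE -exprMn -nrmM.
by rewrite sqrtrM ?sqr_ge0 // sqrtr_sqr ger0_norm ?nrm_ge0.
Qed.

Lemma l2norm0 : l2norm 0 = 0.
Proof. by rewrite -(scale0r 0) l2normZ nrm0 mul0r. Qed.

Lemma l2_CauchySchwarz f h : \sum_g nrm (f g) * nrm (h g) <= l2norm f * l2norm h.
Proof.
rewrite -sqrtrM ?sqnorm_ge0 // -[leLHS]ger0_norm -?sqrtr_sqr.
  by rewrite ler_sqrt ?mulr_ge0 ?sqnorm_ge0 // sumr_CauchySchwarz.
by apply: sumr_ge0 => g _; rewrite mulr_ge0 ?nrm_ge0.
Qed.

Lemma l2normD f h : l2norm (f + h) <= l2norm f + l2norm h.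
Proof.
rewrite -[leRHS]ger0_norm ?addr_ge0 ?l2norm_ge0 // -sqrtr_sqr ler_sqrt ?sqr_ge0 //.
rewrite sqrrD !sqr_l2norm.
have -> : sqnorm f + l2norm f * l2norm h *+ 2 + sqnorm h =
  sqnorm f + sqnorm h + l2norm f * l2norm h *+ 2 by ring.
apply: (@le_trans _ _ (\sum_g (nrm (f g) + nrm (h g)) ^+ 2)).
  apply: ler_sum => g _; rewrite ffunE ler_sqr ?nrmD // nnegrE ?addr_ge0 ?nrm_ge0 //.
under eq_bigr => g _ do rewrite sqrrD addrAC.
rewrite big_split big_split /= lerD2l sumrMnl.
by rewrite lerMn2r l2_CauchySchwarz.
Qed.

Lemma coef_l2norm f g : nrm (f g) <= l2norm f.
Proof.
rewrite -[leLHS]ger0_norm ?nrm_ge0 // -sqrtr_sqr ler_sqrt ?sqnorm_ge0 //.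
by rewrite /sqnorm (bigD1 g) //= lerDl sumr_ge0 // => ? _; rewrite sqr_ge0.
Qed.

(** A first bound on the operator norm; it is far from sharp but equivalent to the
norm, which is all that completeness requires. *)
Definition opbound x : R := Num.sqrt #|gT|%:R * l2norm x.

Lemma l2normM x f : l2norm (x * f) <= opbound x * l2norm f.
Proof.
have coef g : nrm ((x * f) g) <= l2norm x * l2norm f.
  have -> : l2norm f = l2norm [ffun y => f (y^-1 * g)%g].
    congr Num.sqrt; rewrite /sqnorm (reindex_inj invg_inj) /=.
    rewrite (reindex_inj (mulgI g^-1%g)) /=; apply: eq_bigr => y _.
    by rewrite ffunE invMg invgK.
  rewrite ffunE; apply: le_trans (nrm_sum _) _.
  apply: le_trans (l2_CauchySchwarz _ _); apply: ler_sum => y _.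
  by rewrite nrmM ffunE.
rewrite /opbound -mulrA -[l2norm x * _]ger0_norm ?mulr_ge0 ?l2norm_ge0 // -sqrtr_sqr -sqrtrM //.
apply: ler_wsqrtr; rewrite mulr_natl -sumr_const.
apply: ler_sum => g _; rewrite ler_sqr ?nnegrE ?mulr_ge0 ?l2norm_ge0 ?nrm_ge0 //.
Qed.

(** This is the usual scalar product, conjugate-linear on the left ([dotE]); written
as a value at 1, it makes adjunction ([dotM]) an instance of associativity. *)
Definition dot f h : K := (star f * h) 1%g.

Lemma dotE f h : dot f h = \sum_g (f g)^* * h g.
Proof.
rewrite /dot ffunE (reindex_inj invg_inj) /=; apply: eq_bigr => g _.
by rewrite ffunE invgK mulg1.
Qed.

Lemma dot_sqnorm f : dot f f = (sqnorm f)%:C%C.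
Proof.
rewrite dotE rmorph_sum; apply: eq_bigr => g _ /=.
by rewrite mulrC -normCK nrmE rmorphXn.
Qed.

Lemma norm_dot f h : nrm (dot f h) <= l2norm f * l2norm h.
Proof.
rewrite dotE; apply: le_trans (nrm_sum _) _.
apply: le_trans (l2_CauchySchwarz _ _); apply: ler_sum => y _.
rewrite nrmM ler_wpM2r ?nrm_ge0 // -lecR -!nrmE.
by rewrite norm_conjC.
Qed.

Lemma dotM x f h : dot (x * f) h = dot f (star x * h).
Proof. by rewrite /dot starM mulrA. Qed.

Definition opset x : set R := [set l2norm (x * f) | f in [set f | l2norm f <= 1]]%classic.
(** The norm of [x] in the left regular representation. *)
Definition opnorm x : R := sup (opset x).

Lemma opset_ub x : has_sup (opset x).
Proof.
split; first by exists (l2norm (x * 0)), 0 => //=; rewrite l2norm0.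
exists (opbound x) => _ [f /= f1 <-]; apply: le_trans (l2normM _ _) _.
by rewrite ler_piMr // mulr_ge0 ?sqrtr_ge0.
Qed.

Lemma l2norm_mul x f : l2norm (x * f) <= opnorm x * l2norm f.
Proof.
have [f0|f0] := eqVneq (l2norm f) 0.
  by rewrite (l2norm_eq0 f0) mulr0 l2norm0 mulr0.
have fp : 0 < l2norm f by rewrite lt_def f0 l2norm_ge0.
rewrite -ler_pdivrMr //; apply: sup_upper_bound; first exact: opset_ub.
have nf : nrm (l2norm f)%:C%C^-1 = (l2norm f)^-1.
  by apply: complexI; rewrite -nrmE normfV ger0_norm ?ler0c ?l2norm_ge0 // fmorphV.
exists ((l2norm f)%:C%C^-1 *: f); first by rewrite /= l2normZ nf mulVf.
by rewrite -scalerAr l2normZ nf mulrC.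
Qed.

Lemma opnorm_le x c : 0 <= c -> (forall f, l2norm (x * f) <= c * l2norm f) -> opnorm x <= c.
Proof.
move=> c0 xc; apply: ge_sup; first by case: (opset_ub x).
by move=> _ [f /= f1 <-]; apply: le_trans (xc f) _; rewrite ler_piMr.
Qed.

Lemma l2norm1 : l2norm 1 = 1.
Proof.
rewrite -[RHS]sqrtr1; congr Num.sqrt; rewrite /sqnorm (bigD1 1%g) //= big1 => [|g g1].
  by rewrite ffunE eqxx nrm1 expr1n addr0.
by rewrite ffunE (negPf g1) nrm0 expr0n.
Qed.

Lemma l2norm_le_opnorm x : l2norm x <= opnorm x.
Proof. by have := l2norm_mul x 1; rewrite mulr1 l2norm1 mulr1. Qed.

Lemma opnorm_ge0 x : 0 <= opnorm x.
Proof. exact: le_trans (l2norm_ge0 x) (l2norm_le_opnorm x). Qed.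

Lemma opnormM x y : opnorm (x * y) <= opnorm x * opnorm y.
Proof.
apply: opnorm_le => [|f]; first by rewrite mulr_ge0 ?opnorm_ge0.
rewrite -mulrA; apply: le_trans (l2norm_mul _ _) _.
by rewrite -mulrA ler_wpM2l ?opnorm_ge0 ?l2norm_mul.
Qed.

Lemma opnormD x y : opnorm (x + y) <= opnorm x + opnorm y.
Proof.
apply: opnorm_le => [|f]; first by rewrite addr_ge0 ?opnorm_ge0.
by rewrite !mulrDl; apply: le_trans (l2normD _ _) _; rewrite lerD ?l2norm_mul.
Qed.

Lemma opnormZ_le a x : opnorm (a *: x) <= nrm a * opnorm x.
Proof.
apply: opnorm_le => [|f]; first by rewrite mulr_ge0 ?opnorm_ge0 ?nrm_ge0.
by rewrite -scalerAl l2normZ -mulrA ler_wpM2l ?l2norm_mul ?nrm_ge0.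
Qed.

Lemma opnormZ a x : opnorm (a *: x) = nrm a * opnorm x.
Proof.
apply/eqP; rewrite eq_le opnormZ_le /=.
have [->|a0] := eqVneq a 0; first by rewrite nrm0 mul0r opnorm_ge0.
rewrite -{1}[x](scalerK a0); apply: le_trans (ler_wpM2l (nrm_ge0 a) (opnormZ_le _ _)) _.
by rewrite mulrA -nrmM mulfV // nrm1 mul1r.
Qed.

(** The square of [l2norm (x * f)] is the scalar product of [f] and [star x * x * f]. *)
Lemma opnorm_sq_le x : opnorm x ^+ 2 <= opnorm (star x * x).
Proof.
have s0 := opnorm_ge0 (star x * x).
suff : opnorm x <= Num.sqrt (opnorm (star x * x)).
  by move=> le; rewrite -[leRHS]sqr_sqrtr // ler_sqr ?nnegrE ?opnorm_ge0 ?sqrtr_ge0.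
apply: opnorm_le => [|f]; first exact: sqrtr_ge0.
rewrite -[l2norm f]ger0_norm ?l2norm_ge0 // -sqrtr_sqr -sqrtrM //.
apply: ler_wsqrtr; rewrite -lecR -dot_sqnorm dotM mulrA.
have : `|dot f (star x * x * f)| <= (opnorm (star x * x) * l2norm f ^+ 2)%:C%C.
  rewrite nrmE lecR; apply: le_trans (norm_dot _ _) _.
  by rewrite mulrC expr2 mulrA ler_wpM2r ?l2norm_ge0 ?l2norm_mul.
by rewrite -mulrA -dotM dot_sqnorm ger0_norm // ler0c sqnorm_ge0.
Qed.

(** Divide [opnorm x ^+ 2 <= opnorm (star x * x) <= opnorm (star x) * opnorm x] by
[opnorm x]. *)
Lemma opnorm_star_le x : opnorm x <= opnorm (star x).
Proof.
have [x0|x0] := eqVneq (opnorm x) 0; first by rewrite x0 opnorm_ge0.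
have xp : 0 < opnorm x by rewrite lt_def x0 opnorm_ge0.
have := le_trans (opnorm_sq_le x) (opnormM _ _).
by rewrite expr2 ler_pM2r.
Qed.

Lemma opnorm_cstar x : opnorm (star x * x) = opnorm x ^+ 2.
Proof.
apply/eqP; rewrite eq_le opnorm_sq_le andbT; apply: le_trans (opnormM _ _) _.
rewrite expr2; apply: ler_wpM2r; first exact: opnorm_ge0.
by have := opnorm_star_le (star x); rewrite starK.
Qed.

Lemma opnorm_le_bound x : opnorm x <= opbound x.
Proof. by apply: opnorm_le => [|f]; rewrite ?l2normM // mulr_ge0 ?sqrtr_ge0. Qed.

End Norm.

Section CStarInstance.
Variables (R : realType) (gT : finGroupType).
Local Notation K := R[i].
Local Notation CG := (galg K gT).
Implicit Types (x y f h : CG).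

Definition gnorm x : K := (opnorm x)%:C%C.

Lemma gnormD x y : gnorm (x + y) <= gnorm x + gnorm y.
Proof. by rewrite /gnorm -rmorphD lecR opnormD. Qed.

Lemma gnormZ (a : K) x : gnorm (a *: x) = `|a| * gnorm x.
Proof. by rewrite /gnorm opnormZ rmorphM nrmE. Qed.

Lemma gnorm0_eq0 x : gnorm x = 0 -> x = 0.
Proof.
move=> /complexI x0; apply: l2norm_eq0; apply/eqP; rewrite eq_le l2norm_ge0 andbT.
by rewrite -x0 l2norm_le_opnorm.
Qed.

Lemma gnormM x y : gnorm (x * y) <= gnorm x * gnorm y.
Proof. by rewrite /gnorm -rmorphM lecR opnormM. Qed.

Lemma gnorm_star x : gnorm (star x * x) = gnorm x ^+ 2.
Proof. by rewrite /gnorm opnorm_cstar rmorphXn. Qed.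

Lemma complex_cauchy (s : nat -> K) :
  (forall e : R, 0 < e -> exists N, forall m n, (N <= m)%N -> (N <= n)%N ->
     nrm (s m - s n) < e) ->
  exists z : K, forall e : R, 0 < e -> exists N, forall n, (N <= n)%N -> nrm (s n - z) < e.
Proof.
move=> cs.
have real_lim (u : nat -> R) : (forall m n, `|u m - u n| <= nrm (s m - s n)) ->
    exists l, forall e : R, 0 < e -> exists N, forall n, (N <= n)%N -> `|u n - l| < e.
  move=> us; have /cvg_ex[/= l ul] : cvgn u.
    apply: cauchy_cvg; apply: cauchy_exP => e e0; have [N HN] := cs e e0.
    exists (u N); exists N => // n /= Nn; rewrite -ball_normE /=.
    exact: le_lt_trans (us _ _) (HN _ _ (leqnn N) Nn).
  exists l => e e0; have /cvgrPdist_lt/(_ _ e0)[N _ HN] := ul.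
  by exists N => n Nn; rewrite distrC; exact: HN.
have [a aP] : exists a, forall e : R, 0 < e ->
    exists N, forall n, (N <= n)%N -> `|complex.Re (s n) - a| < e.
  by apply: real_lim => m n; rewrite -raddfB /= -lecR -nrmE normc_def lecR
    -sqrtr_sqr ler_wsqrtr // lerDl sqr_ge0.
have [b bP] : exists b, forall e : R, 0 < e ->
    exists N, forall n, (N <= n)%N -> `|complex.Im (s n) - b| < e.
  by apply: real_lim => m n; rewrite -raddfB /= -lecR -nrmE normc_def lecR
    -sqrtr_sqr ler_wsqrtr // lerDr sqr_ge0.
exists (a +i* b)%C => e e0; have e20 : 0 < e / 2 by rewrite divr_gt0.
have [N1 HN1] := aP _ e20; have [N2 HN2] := bP _ e20.
exists (maxn N1 N2) => n; rewrite geq_max => /andP[/HN1 Ha /HN2 Hb].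
apply: (@le_lt_trans _ _ (`|complex.Re (s n) - a| + `|complex.Im (s n) - b|)); last first.
  by rewrite [e]splitr ltrD.
case: (s n) {Ha Hb} => c d /=; rewrite -lecR -nrmE normc_def lecR /=.
rewrite -[leRHS]ger0_norm ?addr_ge0 // -sqrtr_sqr; apply: ler_wsqrtr.
have -> (u v : R) : (`|u| + `|v|) ^+ 2 = u ^+ 2 + v ^+ 2 + (`|u| * `|v|) *+ 2.
  by rewrite sqrrD addrAC !real_normK ?num_real.
rewrite lerDl.
by rewrite mulrn_wge0 ?mulr_ge0.
Qed.

(** The group is finite, so that convergence in norm is convergence of each
coefficient. *)
Lemma gnorm_complete (s : nat -> CG) :
  (forall e : K, 0 < e -> exists N, forall m n, (N <= m)%N -> (N <= n)%N ->
     gnorm (s m - s n) < e) ->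
  exists x, forall e : K, 0 < e -> exists N, forall n, (N <= n)%N ->
     gnorm (s n - x) < e.
Proof.
move=> cs.
have coef g : exists x : K, forall e : R, 0 < e ->
    exists N, forall n, (N <= n)%N -> nrm (s n g - x) < e.
  apply: complex_cauchy => e e0.
  have [|N HN] := cs e%:C%C; first by rewrite ltcR.
  exists N => m n Nm Nn; have := HN m n Nm Nn; rewrite ltcR; apply: le_lt_trans.
  apply: le_trans (l2norm_le_opnorm _).
  by have := coef_l2norm (s m - s n) g; rewrite !ffunE.
have /choice[x xP] := coef.
pose X : CG := [ffun g => x g].
exists X => e e0.
have eE : e = (complex.Re e)%:C%C by rewrite RRe_real // gtr0_real.
move: e0; rewrite eE ltcR; move: (complex.Re e) => {eE}e e0.
pose c : R := Num.sqrt #|gT|%:R.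
have c0 : 0 < c by rewrite sqrtr_gt0 ltr0n; apply/card_gt0P; exists 1%g.
(* Coefficients within d are at distance at most c * (c * d) < e in norm. *)
pose d := e / (c * (c + 1)).
have d0 : 0 < d by rewrite divr_gt0 // mulr_gt0 // addr_gt0.
have /choice[N NP] : forall g, exists N, forall n, (N <= n)%N -> nrm (s n g - x g) < d.
  by move=> g; exact: xP.
exists (\max_g N g)%N => n Nn; rewrite ltcR.
apply: le_lt_trans (opnorm_le_bound _) _; rewrite /opbound -/c.
have : l2norm (s n - X) <= c * d.
  have cd0 : 0 <= c * d by exact: ltW (mulr_gt0 c0 d0).
  rewrite -[c * d](ger0_norm cd0) -sqrtr_sqr; apply: ler_wsqrtr.
  rewrite exprMn sqr_sqrtr ?ler0n // mulr_natl -sumr_const; apply: ler_sum => g _.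
  rewrite !ffunE ler_sqr ?nnegrE ?nrm_ge0 ?(ltW d0) //; apply: ltW; apply: NP.
  by apply: leq_trans Nn; exact: leq_bigmax.
move=> /(ler_wpM2l (ltW c0)) /le_lt_trans; apply.
have c10 : 0 < c + 1 by rewrite addr_gt0.
have -> : c * (c * d) = e * (c / (c + 1)) by rewrite /d; field; rewrite !gt_eqF.
by rewrite gtr_pMr // ltr_pdivrMr // mul1r ltrDl.
Qed.

HB.instance Definition _ := StarAlgebra_isCStar.Build K CG
  gnormD gnormZ gnorm0_eq0 gnormM gnorm_star gnorm_complete.

End CStarInstance.
(** * Star morphisms into a group algebra *)

Section StarBasics.
Variables (K : numClosedFieldType) (A : starAlgType K).
Implicit Types x y : A.

Lemma star1 : star (1 : A) = 1.
Proof. by rewrite -[star 1]mulr1 -[X in _ * X](starK 1) -starM mulr1 starK. Qed.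

Lemma star0 : star (0 : A) = 0.
Proof. by apply: (addrI (star 0)); rewrite -starD !addr0. Qed.

Lemma starX x n : star (x ^+ n) = star x ^+ n.
Proof. by elim: n => [|n IHn]; rewrite ?expr0 ?star1 // exprS starM IHn -exprSr. Qed.

End StarBasics.

Section StarHom.
Variables (K : numClosedFieldType) (A B : starAlgType K) (f : A -> B).
Hypothesis fh : star_hom f.

Lemma star_homD x y : f (x + y) = f x + f y.
Proof. by case: fh => l _ _; have := l 1 x y; rewrite !scale1r. Qed.

Lemma star_hom0 : f 0 = 0.
Proof. by apply: (addrI (f 0)); rewrite -star_homD !addr0. Qed.

Lemma star_homZ a x : f (a *: x) = a *: f x.
Proof. by case: fh => l _ _; have := l a x 0; rewrite !addr0 star_hom0 addr0. Qed.

Lemma star_homB x y : f (x - y) = f x - f y.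
Proof. by rewrite star_homD -scaleN1r star_homZ scaleN1r. Qed.

Lemma star_homM x y : f (x * y) = f x * f y.
Proof. by case: fh => _ [_ ->]. Qed.

Lemma star_hom1 : f 1 = 1.
Proof. by case: fh => _ []. Qed.

Lemma star_hom_star x : f (star x) = star (f x).
Proof. by case: fh. Qed.

Lemma star_hom_sum (I : Type) (r : seq I) (P : pred I) (F : I -> A) :
  f (\sum_(i <- r | P i) F i) = \sum_(i <- r | P i) f (F i).
Proof. exact: (big_morph f star_homD star_hom0). Qed.

Lemma star_hom_nat n : f n%:R = n%:R.
Proof. by elim: n => [|n IHn]; rewrite ?star_hom0 // -addn1 !natrD star_homD IHn star_hom1. Qed.

Lemma magic_map n (u : 'M[A]_n) : magic u -> magic (map_mx f u).
Proof.
case=> pu ru cu; split => [i j|i|j].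
- by have [e s] := pu i j; split; rewrite mxE ?[in RHS]mxE -?star_homM -?star_hom_star ?e ?s.
- by under eq_bigr do rewrite mxE; rewrite -star_hom_sum ru star_hom1.
- by under eq_bigr do rewrite mxE; rewrite -star_hom_sum cu star_hom1.
Qed.

Lemma adjmx_comm_coef n (X : graph n) (u : 'M[A]_n) i j :
  (adjmx B X *m map_mx f u - map_mx f u *m adjmx B X) i j =
  f ((adjmx A X *m u - u *m adjmx A X) i j).
Proof.
rewrite !mxE star_homB !star_hom_sum; congr (_ - _); apply: eq_bigr => k _.
  by rewrite !mxE star_homM star_hom_nat.
by rewrite !mxE star_homM star_hom_nat.
Qed.
End StarHom.

Lemma star_hom_comp (K : numClosedFieldType) (A B C : starAlgType K) (f : A -> B) (g : B -> C) :
  star_hom f -> star_hom g -> star_hom (g \o f).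
Proof.
move=> fh gh; split => [a x y|/=|x /=].
- by rewrite /= (star_homD fh) (star_homZ fh) (star_homD gh) (star_homZ gh).
- split => [|x y /=]; first by rewrite /= (star_hom1 fh) (star_hom1 gh).
  by rewrite (star_homM fh) (star_homM gh).
- by rewrite (star_hom_star fh) (star_hom_star gh).
Qed.

Section CNorm.
Variables (K : numClosedFieldType) (A : cstarAlgType K).
Implicit Types x y : A.

Lemma cnorm0 : cnorm (0 : A) = 0.
Proof. by rewrite -(scale0r (0 : A)) cnormZ normr0 mul0r. Qed.

Lemma cnormN x : cnorm (- x) = cnorm x.
Proof. by rewrite -scaleN1r cnormZ normrN1 mul1r. Qed.

Lemma cnorm_ge0 x : 0 <= cnorm x.
Proof. by have := cnormD x (- x); rewrite subrr cnorm0 cnormN -mulr2n pmulrn_lge0. Qed.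

End CNorm.

Section Neumann.
Variables (R : realType) (A : cstarAlgType R[i]).
Local Notation K := R[i].

Lemma exp_half_lt (e : K) : 0 < e -> exists N, forall n, (N <= n)%N -> 2^-1 ^+ n < e.
Proof.
move=> e0; have eE : (complex.Re e)%:C%C = e by rewrite RRe_real ?gtr0_real.
move: e0; rewrite -eE ltcR => e0.
exists (Num.bound (complex.Re e)^-1) => n Nn.
have := upper_nthrootP Nn; rewrite -ltf_pV2 ?posrE ?invr_gt0 ?exprn_gt0 // invrK.
by rewrite -exprVn -ltcR rmorphXn /= fmorphV rmorph_nat.
Qed.

Lemma neumann (z : A) : cnorm z <= 2^-1 -> exists y, (1 - z) * y = 1.
Proof.
move=> hz.
have zX n : cnorm (z ^+ n.+1) <= 2^-1 ^+ n.+1.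
  elim: n => [|n IHn]; first by rewrite !expr1.
  rewrite exprS [leRHS]exprS; apply: le_trans (cnormM _ _) _.
  by rewrite ler_pM ?cnorm_ge0.
(* Starting the series at z spares a bound on the norm of 1. *)
pose s n := \sum_(i < n) z ^+ i.+1.
have sS n k : cnorm (s (n + k)%N - s n) <= 2^-1 ^+ n - 2^-1 ^+ (n + k).
  elim: k => [|k IHk]; first by rewrite addn0 !subrr cnorm0.
  rewrite addnS /s big_ord_recr /= -/(s _) addrAC; apply: le_trans (cnormD _ _) _.
  have -> : 2^-1 ^+ n - 2^-1 ^+ (n + k).+1 =
     (2^-1 ^+ n - 2^-1 ^+ (n + k)) + 2^-1 ^+ (n + k).+1 :> K by rewrite exprS; field.
  by rewrite lerD.
have sC n m : (n <= m)%N -> cnorm (s m - s n) <= 2^-1 ^+ n.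
  move=> /subnKC <-; apply: le_trans (sS _ _) _.
  by rewrite gerBl exprn_ge0 // invr_ge0 ler0n.
have [y yP] : exists y : A, forall e : K, 0 < e ->
    exists N, forall n, (N <= n)%N -> cnorm (s n - y) < e.
  apply: cnorm_complete => e e0; have [N HN] := exp_half_lt e0.
  exists N => m n Nm Nn; case/orP: (leq_total n m) => le.
    exact: le_lt_trans (sC _ _ le) (HN _ Nn).
  by rewrite -cnormN opprB; exact: le_lt_trans (sC _ _ le) (HN _ Nm).
exists (1 + y); apply/eqP; rewrite -subr_eq0; apply/eqP/cnorm0_eq0/eqP.
have tele n : (1 - z) * (1 + s n) = 1 - z ^+ n.+1.
  elim: n => [|n IHn]; first by rewrite /s big_ord0 addr0 mulr1 expr1.
  rewrite /s big_ord_recr /= -/(s n) addrA mulrDr IHn mulrBl mul1r -exprS.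
  by rewrite addrA subrK.
set c := cnorm _; apply: contraT => c0.
have cp : 0 < c by rewrite lt_def c0 cnorm_ge0.
pose d := 1 + cnorm (1 - z).
have dp : 0 < d by rewrite ltr_wpDr // cnorm_ge0.
have [|N1 H1] := yP (c / 2 / d); first by rewrite !divr_gt0.
have [|N2 H2] := @exp_half_lt (c / 2); first by rewrite divr_gt0.
pose n := maxn N1 N2.
have : c < c.
  have {1}-> : c = cnorm ((1 - z) * (y - s n) - z ^+ n.+1).
    congr cnorm; have e1 : 1 = (1 - z) + (1 - z) * s n + z ^+ n.+1.
      by rewrite -{1}[1 - z]mulr1 -mulrDr tele subrK.
    by rewrite {3}e1 mulrDr mulr1 mulrBr opprD addrA opprD addrACA subrr add0r.
  apply: le_lt_trans (cnormD _ _) _; rewrite cnormN [ltRHS]splitr.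
  apply: ltr_leD; last first.
    by apply: le_trans (zX _) _; apply/ltW/H2; rewrite ltnW // ltnS leq_maxr.
  apply: le_lt_trans (cnormM _ _) _.
  rewrite -[y - _]opprB cnormN.
  have := H1 n (leq_maxl _ _); rewrite ltr_pdivlMr //; apply: le_lt_trans.
  by rewrite mulrC ler_wpM2l ?cnorm_ge0 // lerDr.
by rewrite ltxx.
Qed.
End Neumann.

Section Spectral.
Variables (R : realType) (gT : finGroupType).
Local Notation K := R[i].
Local Notation CG := (galg K gT).
Implicit Types a x : CG.

Lemma star_mul_eq0 x : star x * x = 0 -> x = 0.
Proof.
move=> x0; apply: l2norm_eq0; apply/eqP; rewrite -sqrf_eq0 sqr_l2norm.
by apply/eqP/complexI; rewrite -dot_sqnorm /dot x0 ffunE.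
Qed.

(** If the square of a self-adjoint [b] vanishes, so does [star b * b], hence [b]. *)
Lemma selfadjoint_nilpotent a n : star a = a -> a ^+ n = 0 -> a = 0.
Proof.
move=> sa an; have {an} : a ^+ (2 ^ n) = 0.
  by rewrite -(subnK (ltnW (ltn_expl n (ltnSn 1)))) exprD an mulr0.
elim: n => [|n IHn]; first by rewrite expr1.
rewrite expnSr exprM expr2 => e; apply: IHn; apply: star_mul_eq0.
by rewrite starX sa.
Qed.

(** The powers [a ^+ i] for [i <= #|gT|] are linearly dependent. *)
Lemma galg_integral a : exists2 P : {poly K}, P != 0 & horner_alg a P = 0.
Proof.
pose n := #|gT|.
pose M := \matrix_(i < n.+1, j < n) (a ^+ i) (enum_val j).
have [r [r0 rM]] : exists r : 'rV[K]_n.+1, r != 0 /\ r *m M = 0.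
  have : kermx M != 0.
    rewrite kermx_eq0 -row_leq_rank -ltnNge ltnS; exact: rank_leq_col.
  case/rowV0Pn=> r rM r0; exists r; split => //; exact/sub_kermxP.
exists (\poly_(i < n.+1) r 0 (inord i)).
  apply: contra r0 => /eqP/polyP P0; apply/eqP/rowP => i; rewrite mxE.
  by have := P0 i; rewrite coef_poly ltn_ord inord_val coef0.
rewrite poly_def linear_sum /=; apply/ffunP => g; rewrite !ffunE sum_ffunE.
have e := congr1 (fun v : 'rV_n => v 0 (enum_rank g)) rM; rewrite !mxE in e.
rewrite -[RHS]e.
apply: eq_bigr => i _; rewrite linearZ /= rmorphXn /= horner_algX mulr_algl !ffunE !mxE enum_rankK.
by rewrite inord_val.
Qed.

(** Factor a polynomial that annihilates [a].  If [a - z] were invertible for every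
nonzero [z], all factors but powers of [a] could be cancelled, and [a] would be
nilpotent. *)
Lemma selfadjoint_spectrum a : star a = a -> a != 0 ->
  exists c : K, forall b, (1 - c *: a) * b != 1.
Proof.
move=> sa a0; apply: contrapT => H.
have inv z : z != 0 -> exists b, (a - z%:A) * b = 1.
  move=> z0; have [b hb] : exists b, (1 - z^-1 *: a) * b = 1.
    by apply: contrapT => nb; apply: H; exists z^-1 => b; apply/eqP => hb; apply: nb; exists b.
  exists (- z^-1 *: b); rewrite -scalerAr scaleNr scalerAl -mulNr -[RHS]hb; congr (_ * _).
  by rewrite -scalerN opprB scalerBr scalerA mulVf // scale1r.
have [P P0 aP] := galg_integral a.
have [s Ps] := closed_field_poly_normal P.
have {aP} : horner_alg a (\prod_(z <- s) ('X - z%:P)) = 0.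
  have := aP; rewrite Ps linearZ /= mulr_algl => /eqP; rewrite scaler_eq0 lead_coef_eq0 (negPf P0).
  by move/eqP.
rewrite -[\prod_(_ <- _) _]mulr1 -[X in _ * X](expr0 'X); move: 0%N.
elim: s {Ps} => [|z s IHs] k.
  rewrite big_nil mul1r rmorphXn /= horner_algX => /(selfadjoint_nilpotent sa).
  exact/eqP.
rewrite big_cons; have [->|z0] := eqVneq z 0.
  by rewrite subr0 -mulrA mulrCA -exprS; exact: IHs.
have [b hb] := inv z z0.
rewrite -mulrA mulrC rmorphM rmorphB /= horner_algX horner_algC => e.
by apply: (IHs k); rewrite -[LHS]mulr1 -hb mulrA e mul0r.
Qed.

(** If [x] is a limit of elements [y] of the kernel, then [f x = f (x - y)] with
[x - y] arbitrarily small.  A nonzero [star (f x) * f x] has a nonzero spectral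
value; this contradicts the Neumann series for [star (x - y) * (x - y)]. *)
Lemma star_hom_ker_closed (A : cstarAlgType K) (f : A -> CG) :
  star_hom f -> closed_ideal (fun z : A => f z = 0).
Proof.
move=> fh; split => [x near_x||x y x0 y0|a x x0].
- apply: contrapT => /eqP fx0.
  have a0 : star (f x) * f x != 0 by apply: contra fx0 => /eqP/star_mul_eq0->.
  have [|c cP] := selfadjoint_spectrum _ a0; first by rewrite starM starK.
  pose e := (2 * (`|c| + 1))^-1.
  have e0 : 0 < e by rewrite invr_gt0 mulr_gt0 // ltr_wpDl.
  have [y y0 xy] := near_x e e0.
  have [|b hb] := @neumann R A (c *: (star (x - y) * (x - y))).
    rewrite cnormZ cnorm_star.
    have le1 : cnorm (x - y) <= 1.
      apply: le_trans (ltW xy) _; rewrite invf_le1 ?mulr_gt0 ?ltr_wpDl //.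
      by rewrite mulrDr mulr1 ler_wpDl ?mulr_ge0 // ler1n.
    apply: (@le_trans _ _ (`|c| * cnorm (x - y))).
      by rewrite ler_wpM2l // expr2 ler_piMr ?cnorm_ge0.
    apply: (@le_trans _ _ (`|c| * e)); first by rewrite ler_wpM2l // ltW.
    rewrite /e invfM mulrCA ler_piMr ?invr_ge0 ?ler0n //.
    by rewrite ler_pdivrMr ?mul1r ?lerDl // ltr_wpDl.
  have := cP (f b); rewrite -{2}(star_hom1 fh) -hb (star_homM fh) (star_homB fh).
  rewrite (star_hom1 fh) (star_homZ fh) (star_homM fh) (star_hom_star fh) (star_homB fh).
  by rewrite y0 subr0 eqxx.
- exact: star_hom0.
- by rewrite (star_homD fh) x0 y0 addr0.
- by rewrite !(star_homM fh) x0 mulr0 mul0r.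
Qed.
End Spectral.

Section Universal.
Variables (R : realType) (gT : finGroupType).
Local Notation K := R[i].

(** The data of [frucht_dual] transported to the group algebra, with the universal
property kept for targets that are group algebras of finite groups only. *)
Definition dual_qaut (n : nat) (X : graph n) (w : 'M[galg K gT]_n) : Prop :=
  [/\ magic w,
      adjmx _ X *m w = w *m adjmx _ X,
      forall i j, gcomul (w i j) = \sum_k gtensor (w i k) (w k j),
      forall (rT : finGroupType) (V : 'M[galg K rT]_n), magic V ->
        adjmx _ X *m V = V *m adjmx _ X ->
        exists F : galg K gT -> galg K rT, star_hom F /\ forall i j, F (w i j) = V i j
    & forall (rT : finGroupType) (F1 F2 : galg K gT -> galg K rT),
        star_hom F1 -> star_hom F2 -> (forall i j, F1 (w i j) = F2 (w i j)) -> F1 =1 F2].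

(** Being closed, the kernel of a star morphism that kills the relations contains
the ideal which they generate, so the morphism factors through the quotient. *)
Lemma frucht_dual_qaut : frucht_dual R gT -> exists n (X : graph n) w, @dual_qaut n X w.
Proof.
case=> n [X [B [v [psi [[A [u [pr [[mu univ] prh pr_surj pr_ker prv]]]] psih psi_bij comul]]]]].
pose Q := psi \o pr.
have [w wv] : exists w, w = map_mx psi v by exists (map_mx psi v).
have Qh : star_hom Q := star_hom_comp prh psih.
have Qu i j : Q (u i j) = w i j by rewrite wv -prv !mxE.
have wE : w = map_mx Q u by apply/matrixP => i j; rewrite mxE -Qu.
have [psi' psiK psi'K] := psi_bij.
have Q_surj y : exists a, Q a = y.
  by have [a _ e] := pr_surj (psi' y) I; exists a; rewrite /Q /= e psi'K.
have Qker (I : set A) : closed_ideal I ->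
    (forall i j, I ((adjmx A X *m u - u *m adjmx A X) i j)) -> forall a, Q a = 0 -> I a.
  move=> cI relI a Qa; have : pr a = 0.
    by apply: (bij_inj psi_bij); rewrite (star_hom0 psih).
  move/pr_ker => sm; apply: sm; split => // _ [ij _ <-]; exact: relI.
exists n, X, w; split.
- by rewrite wE; apply: magic_map.
- apply/eqP; rewrite -subr_eq0; apply/eqP/matrixP => i j.
  rewrite wE (adjmx_comm_coef Qh) [RHS]mxE /Q /=.
  rewrite (iffRL (pr_ker _)) ?(star_hom0 psih) // => I [_]; apply.
  by exists (i, j).
- move=> i j; rewrite wv mxE comul; apply: eq_bigr => k _; by rewrite !mxE.
- move=> rT V mV cV.
  have [f0 [[f0h f0u] _]] := univ _ V mV.
  have f0Q a : Q a = 0 -> f0 a = 0.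
    apply: (Qker (fun a => f0 a = 0)); first exact: star_hom_ker_closed.
    by move=> i j; rewrite -(adjmx_comm_coef f0h) f0u cV subrr mxE.
  have /choice[s sK] := Q_surj.
  have FQ a : f0 (s (Q a)) = f0 a.
    apply/eqP; rewrite -subr_eq0 -(star_homB f0h) f0Q ?(star_homB Qh) ?sK ?subrr //.
  exists (f0 \o s); split; last first.
    by move=> i j; rewrite /= -Qu FQ -f0u mxE.
  split => [c x y|/=|x /=].
  + rewrite /= -{1}(sK x) -{1}(sK y) -(star_homZ Qh) -(star_homD Qh) FQ.
    by rewrite (star_homD f0h) (star_homZ f0h).
  + split => [|x y /=]; first by rewrite /= -(star_hom1 Qh) FQ (star_hom1 f0h).
    by rewrite -{1}(sK x) -{1}(sK y) -(star_homM Qh) FQ (star_homM f0h).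
  + by rewrite -{1}(sK x) -(star_hom_star Qh) FQ (star_hom_star f0h).
- move=> rT F1 F2 F1h F2h eqF y.
  pose V : 'M[galg K rT]_n := map_mx F1 w.
  have mw : magic w by rewrite wE; exact: magic_map.
  have [f0 [_ f0_uniq]] := univ _ V (magic_map F1h mw).
  have [a <-] := Q_surj y.
  have e1 : f0 = F1 \o Q.
    by apply: f0_uniq; split; [exact: star_hom_comp|apply/matrixP => i j; rewrite !mxE /= Qu].
  have e2 : f0 = F2 \o Q.
    by apply: f0_uniq; split; [exact: star_hom_comp|apply/matrixP => i j; rewrite !mxE /= Qu eqF].
  by rewrite -[LHS]/((F1 \o Q) a) -[RHS]/((F2 \o Q) a) -e1 -e2.
Qed.
End Universal.
(** * The gluing property *)

Section GroupElements.
Variables (K : numClosedFieldType) (gT : finGroupType).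
Local Notation CG := (galg K gT).

Lemma gelt_inj : injective (@gelt K gT).
Proof.
move=> g h /ffunP/(_ g); rewrite !ffunE eqxx.
by case: (g =P h) => // _ /eqP; rewrite oner_eq0.
Qed.

Lemma galgZE (a : K) (f : CG) x : (a *: f) x = a * f x.
Proof. by rewrite ffunE. Qed.

Lemma gelt_mul g h : gelt K g * gelt K h = gelt K (g * h)%g :> CG.
Proof.
apply/ffunP => x; rewrite !ffunE (bigD1 g) //= big1 ?addr0 => [|y yg].
  by rewrite !ffunE eqxx mul1r -(inj_eq (mulgI g)) mulKVg.
by rewrite ffunE (negPf yg) mul0r.
Qed.

Lemma gelt_star g : star (gelt K g : CG) = gelt K g^-1%g.
Proof. by apply/ffunP => x; rewrite !ffunE rmorph_nat -(inj_eq invg_inj) invgK. Qed.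

Lemma galg_sum (f : CG) : f = \sum_g f g *: (gelt K g : CG).
Proof.
apply/ffunP => x; rewrite sum_ffunE (bigD1 x) //= big1 ?addr0 => [|y yx].
  by rewrite !ffunE eqxx [RHS]mulr1.
by rewrite !ffunE eq_sym (negPf yx) [LHS]mulr0.
Qed.

(** The matrices of the values of [w] at the group elements are orthogonal
idempotents. *)
Lemma comul_coef n (w : 'M[CG]_n) i j x y :
    gcomul (w i j) = \sum_k gtensor (w i k) (w k j) ->
  \sum_k w i k x * w k j y = (x == y)%:R * w i j x.
Proof.
move/ffunP/(_ (x, y)); rewrite /gcomul !sum_ffunE.
under [X in _ = X]eq_bigr do rewrite ffunE.
move=> <-; rewrite (bigD1 x) //= big1 ?addr0 => [|z zx].
  by rewrite !ffunE eqxx mul1r eq_sym mulrC.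
by rewrite !ffunE /= eq_sym (negPf zx) mul0r [LHS]mulr0.
Qed.
End GroupElements.

Section Push.
Variables (K : numClosedFieldType) (gT rT : finGroupType).
Implicit Types (th : gT -> rT) (f : galg K gT).

Definition push th f : galg K rT := \sum_g f g *: (gelt K (th g) : galg K rT).

Lemma push_gelt th g : push th (gelt K g) = gelt K (th g).
Proof.
rewrite /push (bigD1 g) //= big1 ?addr0 => [|x xg]; first by rewrite ffunE eqxx scale1r.
by rewrite ffunE (negPf xg) scale0r.
Qed.

Lemma push_eq th th' f : (forall g, f g != 0 -> th g = th' g) -> push th f = push th' f.
Proof.
move=> e; apply: eq_bigr => g _; have [->|fg] := eqVneq (f g) 0; first by rewrite !scale0r.
by rewrite e.
Qed.

Lemma push_linear th : linear (push th).
Proof.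
move=> a f h; rewrite /push scaler_sumr -big_split; apply: eq_bigr => g _ /=.
by rewrite !ffunE scalerDl scalerA.
Qed.

Lemma push_star_hom th : {morph th : x y / (x * y)%g} -> star_hom (push th).
Proof.
move=> thM; have th1 : th 1%g = 1%g by apply: (mulgI (th 1%g)); rewrite -thM !mulg1.
have thV x : th x^-1%g = (th x)^-1%g by apply: (mulgI (th x)); rewrite -thM !mulgV.
have lin := push_linear th.
have pD f h : push th (f + h) = push th f + push th h.
  by have := lin 1 f h; rewrite !scale1r.
have p0 : push th 0 = 0 by apply: (addrI (push th 0)); rewrite -pD !addr0.
have pZ a f : push th (a *: f) = a *: push th f by have := lin a f 0; rewrite !addr0 p0 addr0.
split => //.
- split; first by rewrite -[1]/(gelt K 1%g) push_gelt th1.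
  move=> f h; rewrite [in LHS](galg_sum f) mulr_suml (big_morph _ pD p0).
  rewrite {2}/push mulr_suml; apply: eq_bigr => x _.
  rewrite -!scalerAl pZ; congr (_ *: _).
  rewrite [in LHS](galg_sum h) mulr_sumr (big_morph _ pD p0).
  rewrite {2}/push mulr_sumr; apply: eq_bigr => y _.
  by rewrite -!scalerAr pZ !gelt_mul push_gelt thM.
- move=> f; rewrite [in LHS](galg_sum f) (big_morph _ (@starD K _) (star0 _)) (big_morph _ pD p0).
  rewrite [in RHS]/push (big_morph _ (@starD K _) (star0 _)); apply: eq_bigr => x _.
  by rewrite !starZ pZ !gelt_star push_gelt thV.
Qed.
End Push.

(** If [x] is not in the subgroup [M], the right translation by [x], on points that
carry a flag, does not commute with flipping the flags over [M].  So the
inclusion of [M] does not determine morphisms out of the whole group. *)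
Section FlagPerm.
Variables (gT : finGroupType) (M : {set gT}).

Definition flag_shift_fun x (u : gT * bool) := ((u.1 * x)%g, u.2).
Lemma flag_shift_inj x : injective (flag_shift_fun x).
Proof. by move=> [a b] [a' b'] [/mulIg-> ->]. Qed.
Definition flag_shift x : {perm gT * bool} := perm (@flag_shift_inj x).

Lemma flag_shiftM : {morph flag_shift : x y / (x * y)%g}.
Proof. by move=> x y; apply/permP => u; rewrite permM !permE /flag_shift_fun /= mulgA. Qed.

Definition flag_flip_fun (u : gT * bool) := (u.1, u.2 (+) (u.1 \in M)).
Lemma flag_flipK : involutive flag_flip_fun.
Proof. by move=> [a b]; rewrite /flag_flip_fun /= addbK. Qed.
Definition flag_flip : {perm gT * bool} := perm (inv_inj flag_flipK).

Lemma flag_comm x : (flag_shift x * flag_flip)%g = (flag_flip * flag_shift x)%g <->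
  forall g, ((g * x)%g \in M) = (g \in M).
Proof.
split=> [e g|e].
  have := congr1 (fun s : {perm gT * bool} => s (g, false)) e.
  by rewrite !permM !permE /flag_shift_fun /flag_flip_fun /= => -[].
apply/permP => -[g b]; rewrite !permM !permE /flag_shift_fun /flag_flip_fun /=.
by rewrite e.
Qed.
End FlagPerm.

Section Structure.
Variables (R : realType) (gT : finGroupType).
Local Notation K := R[i].
Local Notation CG := (galg K gT).

(** Multiplying the sum by [e j] on both sides shows that the sum of the
[star (e k * e j) * (e k * e j)], for [k != j], vanishes; its value at 1 is a sum
of squared norms. *)
Lemma projection_orthogonal (I : finType) (e : I -> CG) i j :
  (forall i, projection (e i)) -> \sum_i e i = 1 -> i != j -> e i * e j = 0.
Proof.
move=> pe se ij.
have : \sum_(k | k != j) star (e k * e j) * (e k * e j) = 0.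
  have [ej sj] := pe j; have : e j * (\sum_k e k) * e j = e j by rewrite se mulr1.
  rewrite mulr_sumr mulr_suml (bigD1 j) //= !ej => /eqP.
  rewrite -subr_eq0 addrAC subrr add0r => /eqP e0.
  rewrite -[RHS]e0; apply: eq_bigr => k _; have [ek sk] := pe k.
  by rewrite starM sj sk !mulrA -(mulrA _ (e k) (e k)) ek.
move/ffunP/(_ 1%g); rewrite sum_ffunE [RHS]ffunE => s0.
have {s0} : \sum_(k | k != j) sqnorm (e k * e j) = 0.
  apply: complexI; rewrite rmorph_sum -[RHS]s0; apply: eq_bigr => k _.
  exact/esym/dot_sqnorm.
move/psumr_eq0P => s0; apply: l2norm_eq0; rewrite /l2norm s0 ?sqrtr0 // => k _.
exact: sqnorm_ge0.
Qed.

Variables (n : nat) (X : graph n) (w : 'M[CG]_n).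
Hypothesis wX : dual_qaut X w.

Definition row_supp (i : 'I_n) : {set gT} := [set g | [exists k, w i k g != 0]].

Lemma coefM i j x y : \sum_k w i k x * w k j y = (x == y)%:R * w i j x.
Proof. by case: wX => _ _ c _ _; exact: comul_coef. Qed.

(** The column [k] of [E_g] is an eigenvector of [w] for the eigenvalue [g]. *)
Lemma row_combination i k g :
  \sum_j w j k g *: w i j = w i k g *: (gelt K g : CG).
Proof.
apply/ffunP => x; rewrite sum_ffunE galgZE [in RHS]ffunE.
under eq_bigr => j _ do rewrite galgZE mulrC.
by rewrite coefM mulrC; case: eqP => [->|]; rewrite ?mulr0.
Qed.

Lemma col_combination i k g :
  \sum_j w k j g *: w j i = w k i g *: (gelt K g : CG).
Proof.
apply/ffunP => x; rewrite sum_ffunE galgZE [in RHS]ffunE.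
under eq_bigr => j _ do rewrite galgZE.
by rewrite coefM mulrC eq_sym.
Qed.

Lemma row_orth i j k : j != k -> w i j * w i k = 0.
Proof. by case: wX => -[pw rw _] _ _ _ _; apply: projection_orthogonal. Qed.

Lemma col_orth i j k : j != k -> w j i * w k i = 0.
Proof.
case: wX => -[pw _ cw] _ _ _ _ jk.
by apply: (@projection_orthogonal _ (w^~ i)).
Qed.

Lemma row_suppP i g : reflect (exists k, w i k g != 0) (g \in row_supp i).
Proof. by rewrite inE; exact: existsP. Qed.

(** Multiply the relations [row_combination] for [g] and for [h]: the entries of a
row of [w] being orthogonal projections, the left-hand side is symmetric. *)
Lemma row_supp_comm i g h : g \in row_supp i -> h \in row_supp i -> commute g h.
Proof.
move=> /row_suppP[k gk] /row_suppP[l hl].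
have key x y p q : \sum_j (w j p x * w j q y) *: w i j =
    (w i p x * w i q y) *: (gelt K (x * y)%g : CG).
  rewrite -gelt_mul -scalerA scalerAr scalerAl -(row_combination i p x) -(row_combination i q y).
  rewrite big_distrlr /=; apply: eq_bigr => j _.
  rewrite (bigD1 j) //= big1 ?addr0 => [|m mj]; last first.
    by rewrite -scalerAl -scalerAr row_orth 1?eq_sym // !scaler0.
  by case: wX => -[pw _ _] _ _ _ _; rewrite -scalerAl -scalerAr (pw i j).1 scalerA.
have e : (w i k g * w i l h) *: (gelt K (g * h)%g : CG) =
    (w i l h * w i k g) *: (gelt K (h * g)%g : CG).
  by rewrite -!key; apply: eq_bigr => j _; rewrite mulrC.
apply: (@gelt_inj K); apply: (scalerI (_ : w i k g * w i l h != 0)).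
  by rewrite mulf_neq0.
by rewrite e; congr (_ *: _); exact: mulrC.
Qed.

Lemma row_suppV i g : (g^-1%g \in row_supp i) -> g \in row_supp i.
Proof.
move=> /row_suppP[k gk]; apply/row_suppP; exists k.
case: wX => -[pw _ _] _ _ _ _; have [_ <-] := pw i k.
by rewrite ffunE conjC_eq0.
Qed.

(** Multiply [col_combination] by [w i k] on the right.  Distinct entries of a column
being orthogonal, this gives [w j i g *: w i k = w j k g *: (g * w i k)].  The sum
over [k] of the left-hand sides is the constant [w j i g]; so, after division by
[g], the row [i] takes a nonzero value at [g^-1]. *)
Lemma col_row_supp i j g : w j i g != 0 -> g \in row_supp i.
Proof.
move=> wji; apply: row_suppV; apply/row_suppP.
case: wX => -[pw rw cw] _ _ _ _.
have e k : w j i g *: w i k = w j k g *: (gelt K g * w i k : CG).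
  rewrite scalerAl -col_combination mulr_suml (bigD1 i) //= big1 ?addr0 => [|l li].
    by rewrite -scalerAl (pw i k).1.
  by rewrite -scalerAl col_orth // scaler0.
have : gelt K g^-1%g * (w j i g *: \sum_k w i k) = \sum_k w j k g *: w i k.
  rewrite scaler_sumr mulr_sumr; apply: eq_bigr => k _.
  by rewrite e -scalerAr mulrA gelt_mul mulVg mul1r.
rewrite rw -scalerAr mulr1 => /ffunP/(_ g^-1%g).
rewrite galgZE ffunE eqxx mulr1 sum_ffunE => s.
apply: contrapT => none; move/eqP: wji; apply; rewrite s big1 // => k _.
rewrite galgZE; have [->|wk] := eqVneq (w i k g^-1%g) 0; first exact: mulr0.
by case: none; exists k.
Qed.

Lemma supp_entry i j g : w i j g != 0 -> (g \in row_supp i) && (g \in row_supp j).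
Proof.
move=> wij; rewrite (col_row_supp wij) andbT.
by apply/row_suppP; exists j.
Qed.

(** Otherwise two distinct morphisms agree on the subgroup generated by the supports,
and the star morphisms they induce agree on the entries of [w]. *)
Lemma row_supp_gen : <<\bigcup_i row_supp i>>%g = [set: gT]%SET.
Proof.
set M := <<_>>%g.
have sM i j g : w i j g != 0 -> g \in M.
  case/supp_entry/andP=> Hi _; apply: mem_gen; apply/bigcupP; by exists i.
pose s := @flag_shift gT; pose b := flag_flip M.
pose s' x := (s x ^ b)%g.
have s'M : {morph s' : x y / (x * y)%g} by move=> x y; rewrite /s' /s flag_shiftM conjMg.
have eq_s g : g \in M -> s g = s' g.
  move=> Mg; apply/esym/conjg_fixP/commgP; apply/flag_comm => h.
  by rewrite groupMr.
case: wX => _ _ _ _ uniq.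
have eqF (f : CG) : push s f = push s' f.
  refine (uniq _ (push s) (push s') (push_star_hom K (@flag_shiftM gT)) (push_star_hom K s'M) _ f).
  by move=> i j; apply: push_eq => g /sM; exact: eq_s.
apply/eqP; rewrite eqEsubset subsetT; apply/subsetP => g _.
have := eqF (gelt K g); rewrite !push_gelt => /gelt_inj/esym/conjg_fixP/commgP.
by move/flag_comm/(_ 1%g); rewrite mul1g group1.
Qed.

(** The matrix [V] obtained from [w] by applying [th i] to the row [i] satisfies the
relations of the graph.  Its columns can be computed with a single morphism as
well ([swap]), since [w i j] is supported in both [row_supp i] and [row_supp j]. *)
Lemma glue_homs (rT : finGroupType) (th : 'I_n -> gT -> rT) :
    (forall i, {morph th i : x y / (x * y)%g}) ->
    (forall i j x, x \in row_supp i -> x \in row_supp j -> th i x = th j x) ->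
  exists2 F : gT -> rT, {morph F : x y / (x * y)%g} & forall i, {in row_supp i, F =1 th i}.
Proof.
move=> thM thE; case: wX => -[pw rw cw] comm_w _ ext _.
have ph i := push_star_hom K (thM i).
have swap i j : push (th i) (w i j) = push (th j) (w i j).
  by apply: push_eq => g /supp_entry/andP[]; exact: thE.
pose V : 'M[galg K rT]_n := \matrix_(i, j) push (th i) (w i j).
have mV : magic V.
  split => [i j|i|j].
  - have [e s] := pw i j; rewrite mxE.
    by split; [rewrite -(star_homM (ph i)) e|rewrite -(star_hom_star (ph i)) s].
  - by under eq_bigr do rewrite mxE; rewrite -(star_hom_sum (ph i)) rw (star_hom1 (ph i)).
  - under eq_bigr do rewrite mxE swap.
    by rewrite -(star_hom_sum (ph j)) cw (star_hom1 (ph j)).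
have cV : adjmx _ X *m V = V *m adjmx _ X.
  apply/matrixP => i k.
  have e1 : (adjmx (galg K rT) X *m V) i k = push (th k) ((adjmx CG X *m w) i k).
    rewrite !mxE (star_hom_sum (ph k)); apply: eq_bigr => j _.
    by rewrite !mxE swap (star_homM (ph k)) (star_hom_nat (ph k)).
  have e2 : (V *m adjmx (galg K rT) X) i k = push (th i) ((w *m adjmx CG X) i k).
    rewrite !mxE (star_hom_sum (ph i)); apply: eq_bigr => j _.
    by rewrite !mxE (star_homM (ph i)) (star_hom_nat (ph i)).
  apply: etrans e1 (etrans _ (esym e2)); rewrite -comm_w.
  apply: push_eq => g eg; apply: thE.
    apply: contraNT eg => Hg; rewrite mxE sum_ffunE big1 // => j _.
    have /eqP w0 : w j k g == 0 by apply: contraNT Hg => /supp_entry/andP[].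
    by rewrite mxE mulr_natl ffunMnE w0 mul0rn.
  rewrite comm_w in eg.
  apply: contraNT eg => Hg; rewrite mxE sum_ffunE big1 // => j _.
  have /eqP w0 : w i j g == 0 by apply: contraNT Hg => /supp_entry/andP[].
  by rewrite mxE mulr_natr ffunMnE w0 mul0rn.
have [F [Fh Fw]] := ext _ _ mV cV.
have Fg i g : g \in row_supp i -> F (gelt K g) = gelt K (th i g).
  case/row_suppP=> k gk; apply: (scalerI gk).
  rewrite -(star_homZ Fh) -push_gelt -(star_homZ (ph i)) -row_combination.
  rewrite (star_hom_sum Fh) (star_hom_sum (ph i)); apply: eq_bigr => j _.
  by rewrite (star_homZ Fh) (star_homZ (ph i)) Fw mxE.
have gD : group_set [set g | `[< exists h, F (gelt K g) = gelt K h >]].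
  apply/group_setP; split; first by rewrite inE; apply/asboolP; exists 1%g; exact: (star_hom1 Fh).
  move=> x y; rewrite !inE => /asboolP[x' ex] /asboolP[y' ey]; apply/asboolP.
  by exists (x' * y')%g; rewrite -gelt_mul (star_homM Fh) ex ey gelt_mul.
have /choice[f fP] : forall g, exists h, F (gelt K g) = gelt K h.
  move=> g; have : g \in [set: gT]%SET by rewrite inE.
  rewrite -row_supp_gen; suff sD : (<<\bigcup_i row_supp i>>%g \subset Group gD).
    by move/(subsetP sD); rewrite inE => /asboolP.
  rewrite gen_subG; apply/bigcupsP => i _; apply/subsetP => h Hh.
  by rewrite inE; apply/asboolP; exists (th i h); exact: Fg.
exists f => [x y|i g Hg]; apply: (@gelt_inj K).
  by rewrite -fP -gelt_mul (star_homM Fh) !fP gelt_mul.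
by rewrite -fP (Fg _ _ Hg).
Qed.
End Structure.
(** * Totality and one-dimensional representations *)

Section Total.
Variables (R : realType) (gT : finGroupType).
Local Notation K := R[i].
Local Notation CG := (galg K gT).

Lemma unit_rootX n m : unit_root R n ^+ m =
  (cos (m%:R * (2 * pi / n%:R)) +i* sin (m%:R * (2 * pi / n%:R)))%C.
Proof.
elim: m => [|m IHm]; first by rewrite expr0 mul0r cos0 sin0.
rewrite exprSr IHm /unit_root; set t := 2 * pi / n%:R.
have -> : m.+1%:R * t = m%:R * t + t by rewrite -addn1 natrD mulrDl mul1r.
rewrite cosD sinD; apply/eqP; rewrite eq_complex /= eqxx /=.
by apply/eqP; ring.
Qed.

Lemma unit_root_pow n : (0 < n)%N -> unit_root R n ^+ n = 1.
Proof.
move=> n0; rewrite unit_rootX mulrC divfK ?pnatr_eq0 -?lt0n //.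
by rewrite mulr_natl cos2pi sin2pi.
Qed.

(** The real part is [1 - 2 sin(x)^2] with [x = pi m / n] between 0 and [pi]. *)
Lemma unit_rootX_neq1 n m : (0 < m < n)%N -> unit_root R n ^+ m != 1.
Proof.
move=> /andP[m0 mn]; have n0 : (0 < n)%N := ltn_trans m0 mn.
apply/eqP; rewrite unit_rootX => -[c1 _].
pose x : R := pi * (m%:R / n%:R).
have x2 : m%:R * (2 * pi / n%:R) = x + x by rewrite /x; field; rewrite pnatr_eq0 -lt0n.
have x0 : 0 < sin x.
  apply: sin_gt0_pi; rewrite mulr_gt0 ?pi_gt0 ?divr_gt0 ?ltr0n //=.
  by rewrite gtr_pMr ?pi_gt0 // ltr_pdivrMr ?ltr0n // mul1r ltr_nat.
have := cos2Dsin2 x; rewrite -{}c1 x2 cosD => e.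
have : sin x ^+ 2 *+ 2 = 0.
  apply/eqP; rewrite -subr_eq0 -[X in _ - X](subrr (cos x ^+ 2 + sin x ^+ 2)) {2}e.
  by apply/eqP; ring.
by apply/eqP; rewrite mulrn_eq0 /= sqrf_eq0 gt_eqF.
Qed.

Lemma unit_root_prim n : (0 < n)%N -> n.-primitive_root (unit_root R n).
Proof.
move=> n0; rewrite /primitive_root_of_unity n0; apply/forallP => i.
rewrite unity_rootE; have [->|ni] := eqVneq i.+1 n; first by rewrite unit_root_pow ?eqxx.
by rewrite (negPf (unit_rootX_neq1 _)) //= ltn_neqAle ni ltn_ord.
Qed.

Lemma sum_shift_expr (A : pzRingType) (x : A) n : x ^+ n = 1 ->
  x * (\sum_(1 <= m < n.+1) x ^+ m) = \sum_(1 <= m < n.+1) x ^+ m.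
Proof.
move=> xn; rewrite big_add1 /= mulr_sumr; case: n xn => [|n] xn; first by rewrite !big_geq.
under [LHS]eq_bigr => i _ do rewrite -exprS.
by rewrite big_nat_recr //= [RHS]big_nat_recl //= (exprS x n.+1) xn mulr1 addrC expr1.
Qed.

Lemma gelt_expr g m : (gelt K g : CG) ^+ m = gelt K (g ^+ m)%g.
Proof. by elim: m => [|m IHm]; rewrite ?expr0 // exprS IHm gelt_mul -expgS. Qed.

(** Let [d] be a divisor of the order of [g], neither 1 nor the order, and let
[h = g ^+ d].  The projection onto the vectors fixed by [g] is orthogonal to any
projection onto a nontrivial eigenspace of [h], while the two magic matrices have
sizes [#[g]] and [#[h]]. *)
Lemma total_prime_orders : total_dual R gT -> forall g : gT, g != 1%g -> prime #[g]%g.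
Proof.
move=> total g g1; apply: contraT => /primePn[|[d /andP[d1 dn] d_dvd]].
  by rewrite ltnNge order_gt1 g1.
have g_gt0 := order_gt0 g.
set h := (g ^+ d)%g; have oh : #[h]%g = (#[g]%g %/ d)%N by exact: orderXdiv.
have h1 : (1 < #[h]%g)%N by rewrite oh ltn_divRL ?mul1n.
have hg : (#[h]%g < #[g]%g)%N by rewrite oh ltn_Pdiv.
pose i0 : 'I_#[g]%g := Ordinal g_gt0.
pose k1 : 'I_#[h]%g := Ordinal h1; pose l0 : 'I_#[h]%g := Ordinal (order_gt0 h).
suff /total[e _] : fourier_magic R g i0 i0 * fourier_magic R h k1 l0 = 0.
  by rewrite e ltnn in hg.
rewrite !mxE -scalerAl -scalerAr; pose S := \sum_(1 <= m < #[g]%g.+1) (gelt K g : CG) ^+ m.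
have -> : \sum_(1 <= m < #[g]%g.+1)
    unit_root R #[g]%g ^ ((i0%:Z - i0%:Z) * m%:Z) *: (gelt K g : CG) ^+ m = S.
  by apply: eq_bigr => m _; rewrite subrr mul0r expr0z scale1r.
have Sg m : S * (gelt K h : CG) ^+ m = S.
  have Sg1 : S * gelt K g = S.
    rewrite -[RHS](@sum_shift_expr _ (gelt K g : CG)); last by rewrite gelt_expr expg_order.
    rewrite mulr_suml mulr_sumr; apply: eq_bigr => k _; by rewrite -exprS -exprSr.
  rewrite gelt_expr /h -expgM -gelt_expr.
  by elim: (d * m)%N => [|k IHk]; rewrite ?expr0 ?mulr1 // exprSr mulrA IHk.
rewrite mulr_sumr.
have -> : \sum_(1 <= m < #[h]%g.+1)
    S * (unit_root R #[h]%g ^ ((k1%:Z - l0%:Z) * m%:Z) *: (gelt K h : CG) ^+ m) =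
    (\sum_(1 <= m < #[h]%g.+1) unit_root R #[h]%g ^+ m) *: S.
  rewrite scaler_suml; apply: eq_bigr => m _; rewrite -scalerAr Sg; congr (_ *: _).
  by rewrite subr0 mul1r.
set T := \sum_(_ <= _ < _) _; suff -> : T = 0 by rewrite scale0r !scaler0.
have /eqP := sum_shift_expr (unit_root_pow (order_gt0 h)).
rewrite -subr_eq0 -/T -{2}[T]mul1r -mulrBl mulf_eq0 subr_eq0.
by have := @unit_rootX_neq1 #[h]%g 1; rewrite expr1 h1 => /(_ isT)/negPf -> /eqP.
Qed.
End Total.

Section CountReps.
Variable gT : finGroupType.
Local Notation m := #|gT|.

(** Exponents of a primitive root of unity of order [#|gT|]: this finite set
parametrizes the one-dimensional representations over every field that contains
such a root, and so compares the complex numbers over [R] with the algebraic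
numbers. *)
Definition log_reps : {set {ffun gT -> 'I_m}} :=
  [set f : {ffun gT -> 'I_m} | [forall x, forall y, f (x * y)%g == f x + f y %[mod m]]].

Section OneField.
Variables (F : fieldType) (z : F).
Hypothesis z_prim : m.-primitive_root z.

Definition rep_of (f : {ffun gT -> 'I_m}) x := z ^+ f x.

Lemma rep_ofM f x y : f \in log_reps -> rep_of f (x * y)%g = rep_of f x * rep_of f y.
Proof.
rewrite inE => /forallP/(_ x)/forallP/(_ y) e.
by apply/eqP; rewrite -exprD (eq_prim_root_expr z_prim).
Qed.

Lemma rep_of_neq0 f x : rep_of f x != 0.
Proof.
rewrite expf_neq0 // (prim_root_eq0 z_prim) -lt0n.
by apply/card_gt0P; exists 1%g.
Qed.

Lemma rep_of_inj f f' : rep_of f =1 rep_of f' -> f = f'.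
Proof.
move=> e; apply/ffunP => x; apply: val_inj; have /eqP := e x.
by rewrite (eq_prim_root_expr z_prim) !modn_small // => /eqP.
Qed.

Lemma rep_of_surj (chi : gT -> F) : (forall x, chi x != 0) ->
    (forall x y, chi (x * y)%g = chi x * chi y) ->
  exists2 f, f \in log_reps & chi =1 rep_of f.
Proof.
move=> chi0 chiM.
have chi1 : chi 1%g = 1 by apply: (mulfI (chi0 1%g)); rewrite -chiM mulg1 mulr1.
have chiX x k : chi (x ^+ k)%g = chi x ^+ k.
  by elim: k => [|k IHk]; rewrite ?chi1 // expgS chiM IHk exprS.
have chim x : chi x ^+ m = 1.
  rewrite -chiX (_ : x ^+ m = 1)%g // -cardsT; apply: (@expg_cardG _ [set: gT]%G); exact: in_setT.
pose f := [ffun x => sval (prim_rootP z_prim (chim x))].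
have fE : chi =1 rep_of f by move=> x; rewrite /rep_of ffunE; case: prim_rootP.
exists f => //; rewrite inE; apply/forallP => x; apply/forallP => y.
by rewrite -(eq_prim_root_expr z_prim) exprD; have := chiM x y; rewrite !fE => /eqP.
Qed.
End OneField.

(** Both sides count the linear characters over the algebraic numbers. *)
Lemma card_log_reps : #|log_reps| = #|[set: gT]%SET : [set: gT]%SET^`(1)|%g.
Proof.
pose G := [set: gT]%G; rewrite -(card_lin_irr G).
have m0 : (0 < m)%N by apply/card_gt0P; exists 1%g.
have [z z_prim] := C_prim_root_exists m0.
pose k f := odflt 0 [pick i : Iirr G | [forall x, 'chi_i x == rep_of z f x]].
have ex_irr f : f \in log_reps ->
    exists2 i : Iirr G, 'chi_i \is a linear_char & forall x, 'chi_i x = rep_of z f x.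
  move=> Lf; pose r x : 'M[algC]_1 := (rep_of z f x)%:M.
  have rP : mx_repr G r.
    split; last by move=> x y _ _; rewrite /r (rep_ofM z_prim) // scalar_mxM.
    congr (_%:M); apply: (mulfI (rep_of_neq0 z_prim f 1%g)).
    by rewrite -rep_ofM // mulg1 mulr1.
  pose phi := cfRepr (MxRepresentation rP).
  have phiE x : phi x = rep_of z f x by rewrite cfunE in_setT mulr1n mxtrace_scalar.
  have lin : phi \is a linear_char by rewrite qualifE /= cfRepr_char cfRepr1 eqxx.
  have /irrP[i phi_i] := lin_char_irr lin.
  by exists i => [|x]; rewrite -phi_i.
have kE f : f \in log_reps -> forall x, 'chi_(k f) x = rep_of z f x.
  case/ex_irr=> i _ iE x; rewrite /k; case: pickP => [j /forallP/(_ x)/eqP //|/(_ i)/negP[]].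
  by apply/forallP => y; rewrite iE.
have k_inj : {in log_reps &, injective k}.
  move=> f f' Lf Lf' e; apply: (rep_of_inj z_prim) => x.
  by rewrite -!kE ?e.
rewrite -(card_in_imset k_inj); apply: eq_card => i; apply/imsetP/idP => [[f Lf ->]|].
  have [j lin jE] := ex_irr f Lf.
  suff -> : k f = j by [].
  by apply: irr_inj; apply/cfunP => x; rewrite kE.
rewrite inE => lin.
have [|x y|f Lf fE] := @rep_of_surj _ z z_prim 'chi_i.
- by move=> x; apply: lin_char_neq0; rewrite ?in_setT.
- by rewrite lin_charM ?in_setT.
by exists f => //; apply: irr_inj; apply/cfunP => x; rewrite kE // fE.
Qed.

Lemma card_one_dim_reps (R : realType) p : (one_dim_reps R gT #= `I_p)%card ->
  #|[set: gT]%SET : [set: gT]%SET^`(1)|%g = p.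
Proof.
move=> /card_set_bijP[g [gI g_inj g_surj]]; rewrite -card_log_reps.
have m0 : (0 < m)%N by apply/card_gt0P; exists 1%g.
have z_prim := unit_root_prim R m0; set z := unit_root R m in z_prim.
have rep f : f \in log_reps -> one_dim_reps R gT (rep_of z f).
  by move=> Lf; split => [x|x y]; [exact: rep_of_neq0|exact: rep_ofM].
have h_inj : {in log_reps &, injective (g \o rep_of z)}.
  move=> f f' Lf Lf' /= e; apply: (rep_of_inj z_prim) => x.
  by rewrite (g_inj _ _ _ _ e) ?in_setE //; exact: rep.
have /perm_size : perm_eq (map (g \o rep_of z) (enum log_reps)) (iota 0 p).
  apply: uniq_perm; last 1 first.
  - move=> k; rewrite mem_iota /= add0n; apply/mapP/idP => [[f + ->]|kp].
      by rewrite mem_enum => /rep/gI.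
    have [chi [chi0 chiM] <-] := g_surj k kp.
    have [f Lf /funext ->] := rep_of_surj z_prim chi0 chiM.
    by exists f => //; rewrite mem_enum.
  - by rewrite map_inj_in_uniq ?enum_uniq // => f f'; rewrite !mem_enum; exact: h_inj.
  - exact: iota_uniq.
by rewrite size_map size_iota -cardE.
Qed.
End CountReps.

(** * The Frucht property *)

Theorem proposition6p4 (R : realType) (p : nat) (gT : finGroupType)
    (p_prime : prime p)
    (nonabelian : ~~ abelian [set: gT]%SET)
    (p_reps : (one_dim_reps R gT #= `I_p)%card)
    (total : total_dual R gT) :
  ~ frucht_dual R gT.
Proof.
move=> /frucht_dual_qaut[n [X [w wX]]]; case/negP: nonabelian.
apply: (@abelian_of_gluing gT 'I_n (row_supp w) p p_prime).
- exact: total_prime_orders total.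
- exact: card_one_dim_reps p_reps.
- by move=> i x y; exact: (row_supp_comm wX).
- exact: (row_supp_gen wX).
- by move=> rT th; exact: (glue_homs wX).
Qed.
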